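(* There is a nontrivial $\sigma^{-1}$-twisted cyclic $2$-cocycle $\tau$ on $\mathcal{O}(S_q^2)$, where $\sigma=K^{-2}$, such that for all $x_0,x_1,x_2\in\mathcal{O}(S^2_q)$ $$\tau(x_0,x_1,x_2)=h\big(x_0\,KF(x_1)\,EK^3(x_2)\big)-h\big(x_0\,EK(x_1)\,K^3F(x_2)\big)-(q^3-q)^{-1}h\big(x_0x_1K^4(x_2)\big).$$
   Context: $k$ is a field of characteristic $0$; $q$ is a nonzero parameter (real, for the $\ast$-structures), not a root of unity, with a fixed square root $q^{1/2}$. $U_q(su_2)$ is the Hopf algebra generated by $E,F,K,K^{-1}$ with $KK^{-1}=K^{-1}K=1$, $KE=qEK$, $FK=qKF$, $EF-FE=\frac{K^2-K^{-2}}{q-q^{-1}}$, $\Delta(K^{\pm1})=K^{\pm1}\otimes K^{\pm1}$, $\Delta(E)=E\otimes K+K^{-1}\otimes E$, $\Delta(F)=F\otimes K+K^{-1}\otimes F$, $\varepsilon(K^{\pm1})=1$, $\varepsilon(E)=\varepsilon(F)=0$, $S(K)=K^{-1}$, $S(E)=-qE$, $S(F)=-q^{-1}F$. $\mathcal{O}(SU_q(2))$ is the coordinate Hopf algebra of the compact quantum group $SU_q(2)$: as a Hopf algebra it is generated by $a,b,c,d$ with $ab=qba$, $ac=qca$, $ad=da+(q-q^{-1})bc$, $bc=cb$, $bd=qdb$, $cd=qdc$, $ad-qbc=1$, and $\Delta(a)=a\otimes a+b\otimes c$, $\Delta(b)=a\otimes b+b\otimes d$, $\Delta(c)=c\otimes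 a+d\otimes c$, $\Delta(d)=c\otimes b+d\otimes d$. The pairing with $U_q(su_2)$ is determined by $\langle K^{\pm1},d\rangle=\langle K^{\mp1},a\rangle=q^{\pm1/2}$, $\langle E,c\rangle=\langle F,b\rangle=1$ (other pairings of $E,F,K^{\pm1}$ with generators being $0$). Coregular actions: $y(x)=x_{(1)}\langle y,x_{(2)}\rangle$, $x\triangleleft y=\langle y,x_{(1)}\rangle x_{(2)}$. $h$ is the Haar state of $\mathcal{O}(SU_q(2))$, the unique invariant functional with $h(1)=1$. The standard Podle\'s sphere is the subalgebra $\mathcal{O}(S_q^2)=\{x\in\mathcal{O}(SU_q(2)) : x\triangleleft K=x\}$, which is stable under the left coregular action; $h$ is restricted to it. For an automorphism $\theta$ of an algebra $\mathcal A$, a $\theta$-twisted cyclic $n$-cocycle is a linear $\varphi:\mathcal A^{\otimes n+1}\to k$ with $\varphi(a_0,\ldots,a_n)=(-1)^n\varphi(\theta(a_n),a_0,\ldots,a_{n-1})$ and $b\varphi=0$, where $$b\varphi(a_0,\ldots,a_{n+1})=\sum_{i=0}^n(-1)^i\varphi(a_0,\ldots,a_ia_{i+1},\ldots,a_{n+1})+(-1)^{n+1}\varphi(\theta(a_{n+1})a_0,a_1,\ldots,a_n);$$ $HC^n_\theta(\mathcal A)$ is the cohomology of the resulting complex, and a cocycle is nontrivial if its class in $HC^n_\theta(\mathcal A)$ is nonzero. Here $\sigma^{-1}$-twisted refers to $\theta(x)=\sigma^{-1}(x)=K^{2}(x)$ on $\mathcal{O}(S^2_q)$ (left coregular action). 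*)

(* Defs.v *)
From HB Require Import structures.
From mathcomp Require Import all_boot all_order all_algebra.
From mathcomp Require Import boolp.
From mathcomp Require Import ring.

Set Implicit Arguments.
Unset Strict Implicit.
Unset Printing Implicit Defensive.

Import GRing.Theory.

Local Open Scope ring_scope.
Local Open Scope quotient_scope.

(* An augmented algebra: the counit is a character of A.  Presented algebras
   and tensor products below carry one; besides being the counit of the Hopf
   algebras at hand, it witnesses 1 != 0, which algType requires. *)
HB.mixin Record Algebra_hasCounit (k : fieldType) A of GRing.Algebra k A := {
  counit : A -> k;
  counit_is_scalar : scalar counit;
  counit_is_monoid_morphism : monoid_morphism counit
}.

#[short(type="augAlgType")]
HB.structure Definition AugAlgebra (k : fieldType) :=
  {A of GRing.Algebra k A & Algebra_hasCounit k A}.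

HB.instance Definition _ (k : fieldType) (A : augAlgType k) :=
  GRing.isLinear.Build k A k *%R (@counit k A) counit_is_scalar.
HB.instance Definition _ (k : fieldType) (A : augAlgType k) :=
  GRing.isMonoidMorphism.Build A k (@counit k A) counit_is_monoid_morphism.

(* Noncommutative polynomial expressions.  The algebra presented by generators
   and relations is their quotient by pres_eq, the congruence generated by the
   axioms of unital associative k-algebras and the relations. *)
Inductive term (k I : Type) :=
  | Gen of I
  | Cst of k
  | Add of term k I & term k I
  | Mul of term k I & term k I.
Arguments Gen {k I}.
Arguments Cst {k I}.

HB.instance Definition _ (k I : Type) := gen_eqMixin (term k I).
HB.instance Definition _ (k I : Type) := gen_choiceMixin (term k I).

Declare Scope presentation_scope.
Delimit Scope presentation_scope with pres.
Bind Scope presentation_scope with term.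
Notation "x + y" := (Add x y) : presentation_scope.
Notation "x * y" := (Mul x y) : presentation_scope.
Notation "x - y" := (Add x (Mul (Cst (-1)%R) y)) : presentation_scope.

Fixpoint eval (k : fieldType) (I : Type) (B : algType k) (f : I -> B)
    (t : term k I) : B :=
  match t with
  | Gen i => f i
  | Cst c => c *: 1
  | Add t u => eval f t + eval f u
  | Mul t u => eval f t * eval f u
  end.

Record presentation (k : fieldType) (I : Type) := Presentation {
  prel : term k I -> term k I -> Prop;
  paug : I -> k^o;
  paug_rel : forall t u, prel t u -> eval paug t = eval paug u
}.

Section Presentation.
Variables (k : fieldType) (I : Type) (P : presentation k I).
Local Notation rel := (prel P).

Inductive pres_eq : term k I -> term k I -> Prop :=
  | PresRel t u : rel t u -> pres_eq t u
  | PresRefl t : pres_eq t t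
  | PresSym t u : pres_eq t u -> pres_eq u t
  | PresTrans t u v : pres_eq t u -> pres_eq u v -> pres_eq t v
  | PresAdd t t' u u' : pres_eq t t' -> pres_eq u u' -> pres_eq (t + u) (t' + u')
  | PresMul t t' u u' : pres_eq t t' -> pres_eq u u' -> pres_eq (t * u) (t' * u')
  | PresAddA t u v : pres_eq (t + (u + v)) (t + u + v)
  | PresAddC t u : pres_eq (t + u) (u + t)
  | PresAdd0 t : pres_eq (Cst 0%R + t) t
  | PresAddN t : pres_eq (t - t) (Cst 0%R)
  | PresMulA t u v : pres_eq (t * (u * v)) (t * u * v)
  | PresMul1 t : pres_eq (Cst 1%R * t) t
  | PresMulDl t u v : pres_eq ((t + u) * v) (t * v + u * v)
  | PresMulDr t u v : pres_eq (t * (u + v)) (t * u + t * v)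
  | PresCstD c d : pres_eq (Cst (c + d)%R) (Cst c + Cst d)
  | PresCstM c d : pres_eq (Cst (c * d)%R) (Cst c * Cst d)
  | PresCstC c t : pres_eq (Cst c * t) (t * Cst c).

Lemma eval_pres_eq (B : algType k) (f : I -> B) :
    (forall t u, rel t u -> eval f t = eval f u) ->
  forall t u, pres_eq t u -> eval f t = eval f u.
Proof.
move=> f_rel t u; elim=> //=.
- by move=> ? ? ? _ -> _ ->.
- by move=> ? ? ? ? _ -> _ ->.
- by move=> ? ? ? ? _ -> _ ->.
- by move=> *; rewrite addrA.
- by move=> *; rewrite addrC.
- by move=> *; rewrite scale0r add0r.
- by move=> ?; rewrite -scalerAl mul1r scaleN1r subrr scale0r.
- by move=> *; rewrite mulrA.
- by move=> *; rewrite scale1r mul1r.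
- by move=> *; rewrite mulrDl.
- by move=> *; rewrite mulrDr.
- by move=> *; rewrite scalerDl.
- by move=> *; rewrite -scalerAl mul1r scalerA.
- by move=> *; rewrite -scalerAl -scalerAr mul1r mulr1.
Qed.

Definition pres_eqb (t u : term k I) : bool := `[< pres_eq t u >].

Fact pres_eqb_refl : reflexive pres_eqb.
Proof. by move=> t; apply/asboolP; apply: PresRefl. Qed.
Fact pres_eqb_sym : symmetric pres_eqb.
Proof. by move=> t u; apply/asboolP/asboolP; apply: PresSym. Qed.
Fact pres_eqb_trans : transitive pres_eqb.
Proof.
by move=> u t v /asboolP tu /asboolP uv; apply/asboolP; apply: PresTrans uv.
Qed.

Canonical pres_equiv := EquivRel pres_eqb pres_eqb_refl pres_eqb_sym pres_eqb_trans.

Definition presented := {eq_quot pres_equiv}.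
HB.instance Definition _ := Choice.on presented.

Definition pclass (t : term k I) : presented := \pi_{eq_quot pres_equiv} t.

Lemma pclassP t u : pclass t = pclass u <-> pres_eq t u.
Proof.
split; first by move/eqmodP/asboolP.
by move=> tu; apply/eqmodP/asboolP.
Qed.

Lemma pclass_eq t u : pres_eq t u -> pclass t = pclass u.
Proof. by move/pclassP. Qed.

Definition prepr (x : presented) : term k I := repr x.

Lemma preprK x : pclass (prepr x) = x.
Proof. exact: reprK. Qed.

Lemma prepr_eq t : pres_eq (prepr (pclass t)) t.
Proof. by apply/pclassP; rewrite preprK. Qed.

Definition padd (x y : presented) := pclass (prepr x + prepr y).
Definition pmul (x y : presented) := pclass (prepr x * prepr y).
Definition pscale (c : k) (x : presented) := pclass (Cst c * prepr x).
Definition popp (x : presented) := pscale (-1) x.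

Lemma paddE t u : padd (pclass t) (pclass u) = pclass (t + u).
Proof. by apply: pclass_eq; apply: PresAdd; apply: prepr_eq. Qed.
Lemma pmulE t u : pmul (pclass t) (pclass u) = pclass (t * u).
Proof. by apply: pclass_eq; apply: PresMul; apply: prepr_eq. Qed.
Lemma pscaleE c t : pscale c (pclass t) = pclass (Cst c * t).
Proof. by apply: pclass_eq; apply: PresMul (prepr_eq t); apply: PresRefl. Qed.

Lemma pres_ind (Q : presented -> Prop) : (forall t, Q (pclass t)) -> forall x, Q x.
Proof. by move=> Qt x; rewrite -[x]preprK. Qed.

Let pE := (paddE, pmulE, pscaleE).

Fact paddA : associative padd.
Proof.
elim/pres_ind=> t; elim/pres_ind=> u; elim/pres_ind=> v.
by rewrite !pE; apply/pclass_eq/PresAddA.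
Qed.
Fact paddC : commutative padd.
Proof.
by elim/pres_ind=> t; elim/pres_ind=> u; rewrite !pE; apply/pclass_eq/PresAddC.
Qed.
Fact padd0 : left_id (pclass (Cst 0)) padd.
Proof. by elim/pres_ind=> t; rewrite !pE; apply/pclass_eq/PresAdd0. Qed.
Fact paddN : left_inverse (pclass (Cst 0)) popp padd.
Proof.
elim/pres_ind=> t; rewrite paddC /popp !pE.
exact/pclass_eq/PresAddN.
Qed.

HB.instance Definition _ :=
  GRing.isZmodule.Build presented paddA paddC padd0 paddN.

Fact pmulA : associative pmul.
Proof.
elim/pres_ind=> t; elim/pres_ind=> u; elim/pres_ind=> v.
by rewrite !pE; apply/pclass_eq/PresMulA.
Qed.
Fact pmul1l : left_id (pclass (Cst 1)) pmul.
Proof. by elim/pres_ind=> t; rewrite !pE; apply/pclass_eq/PresMul1. Qed.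
Fact pmul1r : right_id (pclass (Cst 1)) pmul.
Proof.
elim/pres_ind=> t; rewrite !pE; apply/pclass_eq.
exact: PresTrans (PresSym (PresCstC _ _)) (PresMul1 _).
Qed.
Fact pmulDl : left_distributive pmul padd.
Proof.
elim/pres_ind=> t; elim/pres_ind=> u; elim/pres_ind=> v.
by rewrite !pE; apply/pclass_eq/PresMulDl.
Qed.
Fact pmulDr : right_distributive pmul padd.
Proof.
elim/pres_ind=> t; elim/pres_ind=> u; elim/pres_ind=> v.
by rewrite !pE; apply/pclass_eq/PresMulDr.
Qed.

Fact pone_neq0 : pclass (Cst 1) != pclass (Cst 0).
Proof.
apply/eqP => /pclassP /(eval_pres_eq (@paug_rel _ _ P)) /=.
by rewrite scale1r scale0r => /eqP; rewrite oner_eq0.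
Qed.

HB.instance Definition _ := GRing.Zmodule_isNzRing.Build presented
  pmulA pmul1l pmul1r pmulDl pmulDr pone_neq0.

Fact pscaleA (c d : k) (x : presented) : pscale c (pscale d x) = pscale (c * d) x.
Proof.
elim/pres_ind: x => t; rewrite !pE; apply/pclass_eq.
apply: PresTrans (PresMulA _ _ _) _; apply: PresMul (PresRefl _).
exact/PresSym/PresCstM.
Qed.
Fact pscale1 : left_id 1 pscale.
Proof. by elim/pres_ind=> t; rewrite !pE; apply/pclass_eq/PresMul1. Qed.
Fact pscaleDr : right_distributive pscale +%R.
Proof.
move=> c; elim/pres_ind=> t; elim/pres_ind=> u.
by rewrite /GRing.add /= !pE; apply/pclass_eq/PresMulDr.
Qed.
Fact pscaleDl (x : presented) : {morph pscale^~ x : c d / c + d}.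
Proof.
elim/pres_ind: x => t c d; rewrite [RHS]/GRing.add /= !pE; apply/pclass_eq.
exact: PresTrans (PresMul (PresCstD _ _) (PresRefl _)) (PresMulDl _ _ _).
Qed.

HB.instance Definition _ := GRing.Zmodule_isLmodule.Build k presented
  pscaleA pscale1 pscaleDr pscaleDl.

Fact presented_scalerAl (c : k) (x y : presented) : c *: (x * y) = (c *: x) * y.
Proof.
elim/pres_ind: x => t; elim/pres_ind: y => u.
by rewrite /GRing.scale /GRing.mul /= !pE; apply/pclass_eq/PresMulA.
Qed.
Fact presented_scalerAr (c : k) (x y : presented) : c *: (x * y) = x * (c *: y).
Proof.
elim/pres_ind: x => t; elim/pres_ind: y => u.
rewrite /GRing.scale /GRing.mul /= !pE; apply/pclass_eq.
apply: PresTrans (PresMulA _ _ _) _.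
apply: PresTrans (PresMul (PresCstC _ _) (PresRefl _)) _.
exact/PresSym/PresMulA.
Qed.

HB.instance Definition _ :=
  GRing.Lmodule_isLalgebra.Build k presented presented_scalerAl.
HB.instance Definition _ :=
  GRing.Lalgebra_isAlgebra.Build k presented presented_scalerAr.

Definition pgen (i : I) : presented := pclass (Gen i).

Lemma eval_pgen t : eval pgen t = pclass t.
Proof.
elim: t => //= [c|t -> u ->|t -> u ->]; last 2 first.
- exact: paddE.
- exact: pmulE.
rewrite [LHS]pscaleE; apply: pclass_eq.
exact: PresTrans (PresCstC _ _) (PresMul1 _).
Qed.

Lemma pgen_rel t u : rel t u -> eval pgen t = eval pgen u.
Proof. by move=> tu; rewrite !eval_pgen; apply/pclass_eq/PresRel. Qed.

Section Lift.
Variables (B : algType k) (f : I -> B).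
Variable f_rel : forall t u, rel t u -> eval f t = eval f u.

Definition plift of (forall t u, rel t u -> eval f t = eval f u) :=
  fun x : presented => eval f (prepr x).
Local Notation lift := (plift f_rel).

Lemma plift_class t : lift (pclass t) = eval f t.
Proof. exact: eval_pres_eq f_rel _ _ (prepr_eq t). Qed.

Lemma plift_gen i : lift (pgen i) = f i.
Proof. exact: plift_class. Qed.

Fact plift_is_linear : linear lift.
Proof.
move=> c; elim/pres_ind=> t; elim/pres_ind=> u.
rewrite {1}/GRing.scale {1}/GRing.add /= !pE !plift_class /=.
by rewrite -scalerAl mul1r.
Qed.
Fact plift_is_monoid_morphism : monoid_morphism lift.
Proof.
split; first by rewrite plift_class /= scale1r.
elim/pres_ind=> t; elim/pres_ind=> u.
by rewrite {1}/GRing.mul /= !pE !plift_class.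
Qed.

HB.instance Definition _ := GRing.isLinear.Build k presented B *:%R lift
  plift_is_linear.
HB.instance Definition _ := GRing.isMonoidMorphism.Build presented B lift
  plift_is_monoid_morphism.

End Lift.

Lemma presented_ind (Q : presented -> Prop) :
    (forall i, Q (pgen i)) -> Q 1 ->
    (forall x y, Q x -> Q y -> Q (x + y)) ->
    (forall x y, Q x -> Q y -> Q (x * y)) ->
    (forall c x, Q x -> Q (c *: x)) ->
  forall x, Q x.
Proof.
move=> Qg Q1 QD QM QZ; elim/pres_ind; elim.
- exact: Qg.
- move=> c; rewrite (_ : pclass _ = c *: 1); first exact: QZ.
  rewrite /GRing.scale /GRing.one /= !pE.
  by apply/pclass_eq/PresSym; apply: PresTrans (PresCstC _ _) (PresMul1 _).
- by move=> t Qt u Qu; rewrite -paddE; apply: QD.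
- by move=> t Qt u Qu; rewrite -pmulE; apply: QM.
Qed.

Fact pcounit_is_scalar : scalar (plift (@paug_rel _ _ P) : presented -> k).
Proof. by move=> c x y; apply: (plift_is_linear (@paug_rel _ _ P) c x y). Qed.
HB.instance Definition _ := Algebra_hasCounit.Build k presented
  pcounit_is_scalar (plift_is_monoid_morphism (@paug_rel _ _ P)).

Lemma counit_pgen i : counit (pgen i) = paug P i.
Proof. exact: (plift_gen (@paug_rel _ _ P) i). Qed.

End Presentation.

Arguments pgen {k I P} i.

Section TensorModule.
Variables (k : fieldType) (V W : lmodType k).

(* The tensor product is the set of finite formal sums of pairs (v, w), modulo
   bilinearity. *)
Inductive tens_eq : seq (V * W) -> seq (V * W) -> Prop :=
  | TensRefl s : tens_eq s s
  | TensSym s t : tens_eq s t -> tens_eq t s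
  | TensTrans s t u : tens_eq s t -> tens_eq t u -> tens_eq s u
  | TensCat s s' t t' : tens_eq s s' -> tens_eq t t' -> tens_eq (s ++ t) (s' ++ t')
  | TensCatC s t : tens_eq (s ++ t) (t ++ s)
  | TensDl v v' w : tens_eq [:: (v + v', w)] [:: (v, w); (v', w)]
  | TensDr v w w' : tens_eq [:: (v, w + w')] [:: (v, w); (v, w')]
  | Tens0l w : tens_eq [:: (0, w)] [::]
  | TensZ c v w : tens_eq [:: (c *: v, w)] [:: (v, c *: w)].

Definition tens_eqb s t : bool := `[< tens_eq s t >].

Fact tens_eqb_refl : reflexive tens_eqb.
Proof. by move=> t; apply/asboolP; apply: TensRefl. Qed.
Fact tens_eqb_sym : symmetric tens_eqb.
Proof. by move=> t u; apply/asboolP/asboolP; apply: TensSym. Qed.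
Fact tens_eqb_trans : transitive tens_eqb.
Proof.
by move=> u t v /asboolP tu /asboolP uv; apply/asboolP; apply: TensTrans uv.
Qed.

Canonical tens_equiv := EquivRel tens_eqb tens_eqb_refl tens_eqb_sym tens_eqb_trans.

Definition tens := {eq_quot tens_equiv}.
HB.instance Definition _ := Choice.on tens.

Definition tclass (s : seq (V * W)) : tens := \pi_{eq_quot tens_equiv} s.
Definition trepr (x : tens) : seq (V * W) := repr x.

Lemma tclassP s t : tclass s = tclass t <-> tens_eq s t.
Proof.
split; first by move/eqmodP/asboolP.
by move=> st; apply/eqmodP/asboolP.
Qed.

Lemma tclass_eq s t : tens_eq s t -> tclass s = tclass t.
Proof. by move/tclassP. Qed.

Lemma treprK x : tclass (trepr x) = x.
Proof. exact: reprK. Qed.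

Lemma trepr_eq s : tens_eq (trepr (tclass s)) s.
Proof. by apply/tclassP; rewrite treprK. Qed.

Lemma tclass_ind (Q : tens -> Prop) : (forall s, Q (tclass s)) -> forall x, Q x.
Proof. by move=> Qt x; rewrite -[x]treprK. Qed.

Let scl c := map (fun p : V * W => (c *: p.1, p.2)).

Fact scl_eq c s t : tens_eq s t -> tens_eq (scl c s) (scl c t).
Proof.
elim=> {s t}.
- by move=> s; apply: TensRefl.
- by move=> s t _; apply: TensSym.
- by move=> s t u _ st _ tu; apply: TensTrans st tu.
- by move=> s s' t t' _ ss' _ tt'; rewrite /scl !map_cat; apply: TensCat.
- by move=> s t; rewrite /scl !map_cat; apply: TensCatC.
- by move=> v v' w /=; rewrite scalerDr; apply: TensDl.
- by move=> v w w' /=; apply: TensDr.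
- by move=> w /=; rewrite scaler0; apply: Tens0l.
- by move=> d v w /=; rewrite scalerA mulrC -scalerA; apply: TensZ.
Qed.

Definition tadd (x y : tens) := tclass (trepr x ++ trepr y).
Definition tscale (c : k) (x : tens) := tclass (scl c (trepr x)).

Lemma taddE s t : tadd (tclass s) (tclass t) = tclass (s ++ t).
Proof. by apply: tclass_eq; apply: TensCat; apply: trepr_eq. Qed.
Lemma tscaleE c s : tscale c (tclass s) = tclass (scl c s).
Proof. by apply: tclass_eq; apply/scl_eq/trepr_eq. Qed.

Fact taddA : associative tadd.
Proof.
elim/tclass_ind=> s; elim/tclass_ind=> t; elim/tclass_ind=> u.
by rewrite !taddE catA.
Qed.
Fact taddC : commutative tadd.
Proof.
by elim/tclass_ind=> s; elim/tclass_ind=> t; rewrite !taddE; apply/tclass_eq/TensCatC.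
Qed.
Fact tadd0 : left_id (tclass [::]) tadd.
Proof. by elim/tclass_ind=> s; rewrite taddE. Qed.

Fact tscale_morphD c : {morph tscale c : x y / tadd x y}.
Proof.
elim/tclass_ind=> s; elim/tclass_ind=> t.
by rewrite !(taddE, tscaleE) /scl map_cat.
Qed.

Fact tscaleD (x : tens) c d : tscale (c + d) x = tadd (tscale c x) (tscale d x).
Proof.
elim/tclass_ind: x; elim=> [|[v w] s IHs]; first by rewrite !tscaleE taddE.
rewrite -cat1s -taddE !tscale_morphD IHs.
rewrite !taddA -[in RHS](taddA (tscale c (tclass _))) [tadd (tscale c (tclass s)) _]taddC.
rewrite taddA; congr (tadd (tadd _ _) _).
by rewrite !(taddE, tscaleE) /= scalerDl; apply/tclass_eq/TensDl.
Qed.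

Fact tscale0 (x : tens) : tscale 0 x = tclass [::].
Proof.
elim/tclass_ind: x; elim=> [|[v w] s IHs]; first by rewrite tscaleE.
rewrite -cat1s -taddE tscale_morphD IHs taddC tadd0 tscaleE /= scale0r.
exact/tclass_eq/Tens0l.
Qed.

Fact tscale1 : left_id 1 tscale.
Proof.
elim/tclass_ind=> s; rewrite tscaleE; congr tclass.
by rewrite /scl -[RHS]map_id; apply: eq_map => -[v w]; rewrite scale1r.
Qed.

Fact taddN : left_inverse (tclass [::]) (tscale (-1)) tadd.
Proof. by move=> x; rewrite -{2}[x]tscale1 -tscaleD addNr tscale0. Qed.

HB.instance Definition _ := GRing.isZmodule.Build tens taddA taddC tadd0 taddN.

Fact tscaleA (c d : k) (x : tens) : tscale c (tscale d x) = tscale (c * d) x.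
Proof.
elim/tclass_ind: x => s; rewrite !tscaleE /scl -map_comp; congr tclass.
by apply: eq_map => -[v w] /=; rewrite scalerA.
Qed.

HB.instance Definition _ := GRing.Zmodule_isLmodule.Build k tens
  tscaleA tscale1 tscale_morphD (fun x c d => tscaleD x c d).

Definition pure (v : V) (w : W) : tens := tclass [:: (v, w)].

Lemma tensE x : x = \sum_(p <- trepr x) pure p.1 p.2.
Proof.
rewrite -{1}[x]treprK; elim: (trepr x) => [|[v w] s IHs]; first by rewrite big_nil.
by rewrite big_cons -IHs -cat1s -taddE.
Qed.

Lemma pureDl v v' w : pure (v + v') w = pure v w + pure v' w.
Proof. by rewrite [RHS]taddE; apply/tclass_eq/TensDl. Qed.
Lemma pureDr v w w' : pure v (w + w') = pure v w + pure v w'.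
Proof. by rewrite [RHS]taddE; apply/tclass_eq/TensDr. Qed.
Lemma pureZl c v w : pure (c *: v) w = c *: pure v w.
Proof. by rewrite [RHS]tscaleE. Qed.
Lemma pureZr c v w : pure v (c *: w) = c *: pure v w.
Proof. by rewrite [RHS]tscaleE; apply/tclass_eq/TensSym/TensZ. Qed.

(* For a bilinear beta, the linear map on tensors induced by beta; applied to
   a coproduct it is the Sweedler sum of beta x_(1) x_(2). *)
Definition tsum (X : lmodType k) (beta : V -> W -> X) (x : tens) : X :=
  \sum_(p <- trepr x) beta p.1 p.2.

Definition bilin (X : lmodType k) (beta : V -> W -> X) : Prop :=
  (forall w, linear (beta^~ w)) /\ (forall v, linear (beta v)).

Section Tsum.
Variables (X : lmodType k) (beta : V -> W -> X).
Hypothesis beta_bilin : bilin beta.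

Let betaDl v v' w : beta (v + v') w = beta v w + beta v' w.
Proof. by have := beta_bilin.1 w 1 v v'; rewrite !scale1r. Qed.
Let betaDr v w w' : beta v (w + w') = beta v w + beta v w'.
Proof. by have := beta_bilin.2 v 1 w w'; rewrite !scale1r. Qed.
Let beta0l w : beta 0 w = 0.
Proof. by apply: (addrI (beta 0 w)); rewrite -betaDl !addr0. Qed.
Let beta0r v : beta v 0 = 0.
Proof. by apply: (addrI (beta v 0)); rewrite -betaDr !addr0. Qed.
Let betaZl c v w : beta (c *: v) w = c *: beta v w.
Proof. by have := beta_bilin.1 w c v 0; rewrite !addr0 beta0l addr0. Qed.
Let betaZr c v w : beta v (c *: w) = c *: beta v w.
Proof. by have := beta_bilin.2 v c w 0; rewrite !addr0 beta0r addr0. Qed.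

Lemma tsum_tclass s : tsum beta (tclass s) = \sum_(p <- s) beta p.1 p.2.
Proof.
rewrite /tsum; move: (trepr _) (trepr_eq s) => t; elim=> {s t} //=.
- by move=> s t u _ -> _ ->.
- by move=> s s' t t' _ ss' _ tt'; rewrite !big_cat ss' tt'.
- by move=> s t; rewrite !big_cat /= addrC.
- by move=> *; rewrite !(big_cons, big_nil) !addr0 betaDl.
- by move=> *; rewrite !(big_cons, big_nil) !addr0 betaDr.
- by move=> *; rewrite !(big_cons, big_nil) beta0l addr0.
- by move=> *; rewrite !(big_cons, big_nil) !addr0 betaZl betaZr.
Qed.

Lemma tsum_pure v w : tsum beta (pure v w) = beta v w.
Proof. by rewrite tsum_tclass big_seq1. Qed.

Lemma tsum_is_linear : linear (tsum beta).
Proof.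
move=> c; elim/tclass_ind=> s; elim/tclass_ind=> t.
have -> : c *: tclass s + tclass t = tclass (scl c s ++ t).
  by rewrite -taddE -tscaleE.
rewrite !tsum_tclass big_cat /= big_map scaler_sumr; congr (_ + _); apply: eq_bigr => p _.
exact: betaZl.
Qed.

End Tsum.

End TensorModule.

Section TensorAlgebra.
Variables (k : fieldType) (A B : augAlgType k).
Local Notation T := (tens A B).

Let prodl (a : A) (b : B) (y : T) : T :=
  tsum (fun a' b' => pure (a * a') (b * b')) y.

Definition tmul (x y : T) : T := tsum (fun a b => prodl a b y) x.
Definition tone : T := pure 1 1.

Let prodl_bilin (a : A) (b : B) :
  bilin (fun a' b' => pure (a * a') (b * b')).
Proof.
split=> [b' | a'] c u v /=.
  by rewrite mulrDr -scalerAr pureDl pureZl.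
by rewrite mulrDr -scalerAr pureDr pureZr.
Qed.

Let prodl_pure a b a' b' : prodl a b (pure a' b') = pure (a * a') (b * b').
Proof. exact: (tsum_pure (prodl_bilin a b)). Qed.

Let tmul_bilin y : bilin (fun a b => prodl a b y).
Proof.
split=> [b | a] c u v /=; rewrite /prodl /tsum scaler_sumr -big_split /=;
  apply: eq_bigr => p _.
  by rewrite mulrDl -scalerAl pureDl pureZl.
by rewrite mulrDl -scalerAl pureDr pureZr.
Qed.

Lemma tmul_pure a b a' b' :
  tmul (pure a b) (pure a' b') = pure (a * a') (b * b').
Proof. by rewrite /tmul (tsum_pure (tmul_bilin _)) prodl_pure. Qed.

Fact tmul_linearl y : linear (tmul^~ y).
Proof. exact: (tsum_is_linear (tmul_bilin y)). Qed.
Fact tmul_linearr x : linear (tmul x).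
Proof.
move=> c y z; rewrite /tmul /tsum scaler_sumr -big_split /=.
by apply: eq_bigr => p _; apply: (tsum_is_linear (prodl_bilin _ _)).
Qed.

Fact tmulDl : left_distributive tmul +%R.
Proof. by move=> x y z; have := tmul_linearl z 1 x y; rewrite !scale1r. Qed.
Fact tmulDr : right_distributive tmul +%R.
Proof. by move=> x y z; have := tmul_linearr x 1 y z; rewrite !scale1r. Qed.
Fact tmul0 y : tmul 0 y = 0.
Proof. by apply: (addrI (tmul 0 y)); rewrite -tmulDl !addr0. Qed.
Fact tmulr0 x : tmul x 0 = 0.
Proof. by apply: (addrI (tmul x 0)); rewrite -tmulDr !addr0. Qed.

Lemma tens_ind (Q : T -> Prop) :
  (forall a b, Q (pure a b)) -> Q 0 -> (forall x y, Q x -> Q y -> Q (x + y)) ->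
  forall x, Q x.
Proof. by move=> Qp Q0 QD x; rewrite (tensE x); apply: big_ind. Qed.

Fact tmulA : associative tmul.
Proof.
move=> x y z; elim/tens_ind: x => [a b||x x' IH IH']; last 2 first.
- by rewrite !tmul0.
- by rewrite !tmulDl IH IH'.
elim/tens_ind: y => [a' b'||y y' IH IH']; last 2 first.
- by rewrite tmul0 !tmulr0 tmul0.
- by rewrite !(tmulDl, tmulDr) IH IH'.
elim/tens_ind: z => [a'' b''||z z' IH IH']; last 2 first.
- by rewrite !tmulr0.
- by rewrite !tmulDr IH IH'.
by rewrite !tmul_pure !mulrA.
Qed.
Fact tmul1l : left_id tone tmul.
Proof.
elim/tens_ind=> [a b||x y IH IH']; first by rewrite tmul_pure !mul1r.
  by rewrite tmulr0.
by rewrite tmulDr IH IH'.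
Qed.
Fact tmul1r : right_id tone tmul.
Proof.
elim/tens_ind=> [a b||x y IH IH']; first by rewrite tmul_pure !mulr1.
  by rewrite tmul0.
by rewrite tmulDl IH IH'.
Qed.

Definition tcounit (x : T) : k :=
  tsum (X := k^o) (fun a b => counit a * counit b) x.

Let tcounit_bilin : bilin (X := k^o) (fun (a : A) (b : B) => counit a * counit b).
Proof.
split=> [b | a] c u v; rewrite linearP /=.
  by rewrite mulrDl -mulrA.
by rewrite mulrDr mulrCA.
Qed.

Fact tcounit_is_scalar : scalar tcounit.
Proof. exact: (tsum_is_linear tcounit_bilin). Qed.

Let tcounit_pure a b : tcounit (pure a b) = counit a * counit b.
Proof. exact: (tsum_pure tcounit_bilin). Qed.

Fact tone_neq0 : tone != 0.
Proof.
apply/eqP => /(congr1 tcounit); rewrite tcounit_pure !rmorph1 mulr1.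
rewrite /tcounit (tsum_tclass tcounit_bilin) big_nil.
by apply/eqP; rewrite oner_eq0.
Qed.

HB.instance Definition _ := GRing.Zmodule_isNzRing.Build T
  tmulA tmul1l tmul1r tmulDl tmulDr tone_neq0.

Fact tens_scalerAl (c : k) (x y : T) : c *: (x * y) = (c *: x) * y.
Proof.
have := tmul_linearl y c x 0; rewrite addr0 tmul0 addr0 => <-.
by [].
Qed.
Fact tens_scalerAr (c : k) (x y : T) : c *: (x * y) = x * (c *: y).
Proof.
have := tmul_linearr x c y 0; rewrite addr0 tmulr0 addr0 => <-.
by [].
Qed.

HB.instance Definition _ := GRing.Lmodule_isLalgebra.Build k T tens_scalerAl.
HB.instance Definition _ := GRing.Lalgebra_isAlgebra.Build k T tens_scalerAr.

Fact tcounit_is_monoid_morphism : monoid_morphism tcounit.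
Proof.
have tcD x y : tcounit (x + y) = tcounit x + tcounit y.
  by have := tcounit_is_scalar 1 x y; rewrite scale1r mul1r.
have tc0 : tcounit 0 = 0 by apply: (addrI (tcounit 0)); rewrite -tcD !addr0.
split; first by rewrite [LHS]tcounit_pure !rmorph1 mulr1.
elim/tens_ind=> [a b||x x' IH IH'] y; last 2 first.
- by rewrite mul0r tc0 mul0r.
- by rewrite mulrDl !tcD IH IH' mulrDl.
elim/tens_ind: y => [a' b'||y y' IH IH']; last 2 first.
- by rewrite mulr0 tc0 mulr0.
- by rewrite mulrDr !tcD IH IH' mulrDr.
by rewrite [X in tcounit X]tmul_pure !tcounit_pure !rmorphM mulrACA.
Qed.

HB.instance Definition _ := Algebra_hasCounit.Build k T
  tcounit_is_scalar tcounit_is_monoid_morphism.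

Lemma pureM a b a' b' : pure a b * pure a' b' = pure (a * a') (b * b') :> T.
Proof. exact: tmul_pure. Qed.

Lemma pure1 : pure 1 1 = 1 :> T.
Proof. by []. Qed.

End TensorAlgebra.

Section LinearCombinations.
Variables (k : fieldType) (V : lmodType k).

Inductive lexp :=
  | LAtom of nat
  | LAdd of lexp & lexp
  | LScale of k & lexp.

Fixpoint leval (env : seq V) (e : lexp) : V :=
  match e with
  | LAtom i => env`_i
  | LAdd e f => leval env e + leval env f
  | LScale c e => c *: leval env e
  end.

Fixpoint lcoef (i : nat) (e : lexp) : k :=
  match e with
  | LAtom j => if i == j then 1 else 0
  | LAdd e f => lcoef i e + lcoef i f
  | LScale c e => c * lcoef i e
  end.

Lemma leval_coef env e : leval env e = \sum_(i < size env) lcoef i e *: env`_i.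
Proof.
elim: e => [j|e IHe f IHf|c e IH] /=.
- have [ltj|gej] := ltnP j (size env); last first.
    rewrite nth_default // big1 // => i _.
    by rewrite (_ : (_ == _) = false) ?scale0r // ltn_eqF // (leq_trans _ gej).
  rewrite (bigD1 (Ordinal ltj)) //= eqxx scale1r big1 ?addr0 // => i.
  by rewrite -val_eqE /= => /negbTE ->; rewrite scale0r.
- by rewrite IHe IHf -big_split; apply: eq_bigr => i _; rewrite scalerDl.
- by rewrite IH scaler_sumr; apply: eq_bigr => i _; rewrite scalerA.
Qed.

Lemma leval_eq env e f :
  foldr (fun i Q => lcoef i e = lcoef i f /\ Q) True (iota 0 (size env)) ->
  leval env e = leval env f.
Proof.
move=> ef; rewrite !leval_coef; apply: eq_bigr => i _; congr (_ *: _).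
have: (i : nat) \in iota 0 (size env) by rewrite mem_iota /=.
elim: (iota _ _) ef => //= j js IH [efj efs].
by rewrite inE => /orP[/eqP->|/(IH efs)].
Qed.

End LinearCombinations.

Ltac atom_index v env :=
  match env with
  | ?w :: _ => let _ := constr:(erefl : w = v) in constr:(0%N)
  | _ :: ?env' => let n := atom_index v env' in constr:(n.+1)
  end.
Ltac add_atom v env :=
  match env with
  | _ => let n := atom_index v env in env
  | _ => constr:(v :: env)
  end.
Ltac atoms e env :=
  lazymatch e with
  | ?x + ?y => let env' := atoms x env in atoms y env'
  | _ *: ?x => atoms x env
  | ?x => add_atom x env
  end.
Ltac reify k e env :=
  lazymatch e with
  | ?x + ?y =>
      let a := reify k x env in let b := reify k y env in constr:(LAdd a b)
  | ?c *: ?x => let a := reify k x env in constr:(LScale c a)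
  | ?x => let n := atom_index x env in constr:(@LAtom k n)
  end.
(* Reduces an equality of linear combinations to equalities of coefficients. *)
Ltac lincomb k :=
  match goal with
  | |- @eq ?V ?x ?y =>
      let env0 := atoms x (@nil V) in let env := atoms y env0 in
      let a := reify k x env in let b := reify k y env in
      change (leval env a = leval env b); apply: leval_eq;
      rewrite /=; repeat split
  end.

Inductive uq_gen := gE | gF | gK | gKi.
Inductive suq_gen := ga | gb | gc | gd.

(* The parameter s is the fixed square root of q. *)
Section QuantumGroups.
Variables (k : fieldType) (s : k).
Local Notation q := (s ^+ 2).

Section Relations.
Local Notation E := (Gen gE : term k uq_gen).
Local Notation F := (Gen gF : term k uq_gen).
Local Notation K := (Gen gK : term k uq_gen).
Local Notation Ki := (Gen gKi : term k uq_gen).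

Inductive uq_rel : term k uq_gen -> term k uq_gen -> Prop :=
  | UqKKi : uq_rel (K * Ki) (Cst 1%R)
  | UqKiK : uq_rel (Ki * K) (Cst 1%R)
  | UqKE : uq_rel (K * E) (Cst q * (E * K))
  | UqFK : uq_rel (F * K) (Cst q * (K * F))
  | UqEF : uq_rel (E * F - F * E) (Cst (q - q^-1)^-1%R * (K * K - Ki * Ki)).

Local Notation a := (Gen ga : term k suq_gen).
Local Notation b := (Gen gb : term k suq_gen).
Local Notation c := (Gen gc : term k suq_gen).
Local Notation d := (Gen gd : term k suq_gen).

Inductive suq_rel : term k suq_gen -> term k suq_gen -> Prop :=
  | SUq_ab : suq_rel (a * b) (Cst q * (b * a))
  | SUq_ac : suq_rel (a * c) (Cst q * (c * a))
  | SUq_ad : suq_rel (a * d) (d * a + Cst (q - q^-1)%R * (b * c))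
  | SUq_bc : suq_rel (b * c) (c * b)
  | SUq_bd : suq_rel (b * d) (Cst q * (d * b))
  | SUq_cd : suq_rel (c * d) (Cst q * (d * c))
  | SUq_det : suq_rel (a * d - Cst q * (b * c)) (Cst 1%R).

End Relations.

Definition uq_counit (g : uq_gen) : k^o :=
  match g with gK | gKi => 1 | gE | gF => 0 end.
Definition suq_counit (g : suq_gen) : k^o :=
  match g with ga | gd => 1 | gb | gc => 0 end.

Fact uq_counit_rel t u : uq_rel t u -> eval uq_counit t = eval uq_counit u.
Proof. by case=> /=; rewrite /GRing.scale /=; ring. Qed.
Fact suq_counit_rel t u : suq_rel t u -> eval suq_counit t = eval suq_counit u.
Proof. by case=> /=; rewrite /GRing.scale /=; ring. Qed.

Definition uq_pres := Presentation uq_counit_rel.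
Definition suq_pres := Presentation suq_counit_rel.

Definition uq_su2 : augAlgType k := presented uq_pres.
Definition O_SUq2 : augAlgType k := presented suq_pres.

Definition uE : uq_su2 := pgen gE.
Definition uF : uq_su2 := pgen gF.
Definition uK : uq_su2 := pgen gK.
Definition uKi : uq_su2 := pgen gKi.

Definition oa : O_SUq2 := pgen ga.
Definition ob : O_SUq2 := pgen gb.
Definition oc : O_SUq2 := pgen gc.
Definition od : O_SUq2 := pgen gd.

Lemma uq_KKi : uK * uKi = 1.
Proof. by have := pgen_rel (P := uq_pres) UqKKi; rewrite /= scale1r. Qed.
Lemma uq_KiK : uKi * uK = 1.
Proof. by have := pgen_rel (P := uq_pres) UqKiK; rewrite /= scale1r. Qed.
Lemma uq_KE : uK * uE = q *: (uE * uK).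
Proof. by have := pgen_rel (P := uq_pres) UqKE; rewrite /= -scalerAl mul1r. Qed.
Lemma uq_FK : uF * uK = q *: (uK * uF).
Proof. by have := pgen_rel (P := uq_pres) UqFK; rewrite /= -scalerAl mul1r. Qed.
Lemma uq_EF : uE * uF - uF * uE = (q - q^-1)^-1 *: (uK * uK - uKi * uKi).
Proof.
have := pgen_rel (P := uq_pres) UqEF.
by rewrite /= -!scalerAl !mul1r !scaleN1r.
Qed.

Lemma suq_ab : oa * ob = q *: (ob * oa).
Proof. by have := pgen_rel (P := suq_pres) SUq_ab; rewrite /= -scalerAl mul1r. Qed.
Lemma suq_ac : oa * oc = q *: (oc * oa).
Proof. by have := pgen_rel (P := suq_pres) SUq_ac; rewrite /= -scalerAl mul1r. Qed.
Lemma suq_ad : oa * od = od * oa + (q - q^-1) *: (ob * oc).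
Proof. by have := pgen_rel (P := suq_pres) SUq_ad; rewrite /= -scalerAl mul1r. Qed.
Lemma suq_bc : ob * oc = oc * ob.
Proof. exact: (pgen_rel (P := suq_pres) SUq_bc). Qed.
Lemma suq_bd : ob * od = q *: (od * ob).
Proof. by have := pgen_rel (P := suq_pres) SUq_bd; rewrite /= -scalerAl mul1r. Qed.
Lemma suq_cd : oc * od = q *: (od * oc).
Proof. by have := pgen_rel (P := suq_pres) SUq_cd; rewrite /= -scalerAl mul1r. Qed.
Lemma suq_det : oa * od - q *: (ob * oc) = 1.
Proof.
have := pgen_rel (P := suq_pres) SUq_det.
by rewrite /= -!scalerAl !mul1r scaleN1r scale1r.
Qed.

Definition uq_delta (g : uq_gen) : tens uq_su2 uq_su2 :=
  match g with
  | gE => pure uE uK + pure uKi uE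
  | gF => pure uF uK + pure uKi uF
  | gK => pure uK uK
  | gKi => pure uKi uKi
  end.

Definition suq_delta (g : suq_gen) : tens O_SUq2 O_SUq2 :=
  match g with
  | ga => pure oa oa + pure ob oc
  | gb => pure oa ob + pure ob od
  | gc => pure oc oa + pure od oc
  | gd => pure oc ob + pure od od
  end.

Fact uq_delta_rel t u : uq_rel t u -> eval uq_delta t = eval uq_delta u.
Proof.
have EKi : uE * uKi = q *: (uKi * uE).
  rewrite -[LHS]mul1r -uq_KiK -[uKi * uK * _]mulrA (mulrA uK) uq_KE.
  by rewrite -scalerAl -mulrA uq_KKi mulr1 scalerAr.
have KiF : uKi * uF = q *: (uF * uKi).
  rewrite -[LHS]mulr1 -uq_KKi mulrA -(mulrA uKi) uq_FK.
  by rewrite -scalerAr mulrA uq_KiK mul1r scalerAl.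
case=> /=; do ?rewrite -scalerAl; rewrite ?mul1r.
- by rewrite pureM uq_KKi scale1r.
- by rewrite pureM uq_KiK scale1r.
- rewrite !(mulrDl, mulrDr, pureM) uq_KE uq_KKi uq_KiK !(pureZl, pureZr).
  by rewrite scalerDr.
- rewrite !(mulrDl, mulrDr, pureM) uq_FK uq_KKi uq_KiK !(pureZl, pureZr).
  by rewrite scalerDr.
have EF : uE * uF = uF * uE + (q - q^-1)^-1 *: (uK * uK + (-1) *: (uKi * uKi)).
  by rewrite scaleN1r -uq_EF addrC subrK.
rewrite !(mulrDl, mulrDr, pureM) EF EKi KiF uq_KE uq_FK.
rewrite !(pureDl, pureDr, pureZl, pureZr).
by lincomb k; ring.
Qed.

Definition uq_comul : uq_su2 -> tens uq_su2 uq_su2 :=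
  plift (P := uq_pres) (f := uq_delta) uq_delta_rel.

HB.instance Definition _ := GRing.Linear.on uq_comul.
HB.instance Definition _ := GRing.RMorphism.on uq_comul.

Section SUqComultiplication.
Hypothesis s_neq0 : s != 0.

Fact suq_delta_rel t u : suq_rel t u -> eval suq_delta t = eval suq_delta u.
Proof.
have cb := esym suq_bc.
have ad : oa * od = 1 + q *: (ob * oc) by apply/eqP; rewrite -subr_eq suq_det.
have da : od * oa = 1 + q^-1 *: (ob * oc).
  apply: (addIr ((q - q^-1) *: (ob * oc))); rewrite -suq_ad ad -addrA -scalerDl.
  by rewrite [_^-1 + _]addrC subrK.
have db : od * ob = q^-1 *: (ob * od).
  by rewrite suq_bd scalerA mulVf ?scale1r // expf_neq0.
have dc : od * oc = q^-1 *: (oc * od).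
  by rewrite suq_cd scalerA mulVf ?scale1r // expf_neq0.
case=> /=; do ?rewrite -scalerAl; rewrite ?mul1r.
all: rewrite !(mulrDl, mulrDr, pureM) ?ad ?da ?suq_ab ?suq_ac ?cb ?db ?dc.
all: rewrite !(pureDl, pureDr, pureZl, pureZr) ?pure1.
all: by lincomb k; field.
Qed.

Definition suq_comul : O_SUq2 -> tens O_SUq2 O_SUq2 :=
  plift (P := suq_pres) (f := suq_delta) suq_delta_rel.

HB.instance Definition _ := GRing.Linear.on suq_comul.
HB.instance Definition _ := GRing.RMorphism.on suq_comul.

(* The dual pairing <y, x>.  The antipodes are left out throughout: they are
   determined by the bialgebra structures and any bialgebra pairing respects
   them. *)
Record dual_pairing := DualPairing {
  pair :> uq_su2 -> O_SUq2 -> k;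
  pair_scalarl : forall x, scalar (pair^~ x);
  pair_scalarr : forall y, scalar (pair y);
  pair_mull : forall y z x, pair (y * z) x =
    tsum (X := k^o) (fun x1 x2 => pair y x1 * pair z x2) (suq_comul x);
  pair_mulr : forall y x z, pair y (x * z) =
    tsum (X := k^o) (fun y1 y2 => pair y1 x * pair y2 z) (uq_comul y);
  pair_1l : forall x, pair 1 x = counit x;
  pair_1r : forall y, pair y 1 = counit y;
  pair_gen : forall g g', pair (pgen g) (pgen g') =
    match g, g' with
    | gK, gd | gKi, ga => s
    | gK, ga | gKi, gd => s^-1
    | gE, gc | gF, gb => 1
    | _, _ => 0
    end
}.

(* For beta x1 x2 = h x2 *: x1, the tsum is (id tensor h) Delta(x). *)
Definition is_haar (h : {scalar O_SUq2}) : Prop :=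
  [/\ h 1 = 1,
      forall x, tsum (fun x1 x2 => h x2 *: x1) (suq_comul x) = h x *: 1
    & forall x, tsum (fun x1 x2 => h x1 *: x2) (suq_comul x) = h x *: 1].

Section Actions.
Variable P : dual_pairing.

(* The left and right coregular actions of y on x. *)
Definition lact (y : uq_su2) (x : O_SUq2) : O_SUq2 :=
  tsum (fun x1 x2 => P y x2 *: x1) (suq_comul x).
Definition ract (x : O_SUq2) (y : uq_su2) : O_SUq2 :=
  tsum (fun x1 x2 => P y x1 *: x2) (suq_comul x).

Fact lact_bilin y : bilin (fun x1 x2 : O_SUq2 => P y x2 *: x1).
Proof.
split=> [x2 | x1] c u v /=; first by rewrite scalerDr !scalerA mulrC.
by rewrite pair_scalarr scalerDl scalerA.
Qed.

Fact ract_bilin y : bilin (fun x1 x2 : O_SUq2 => P y x1 *: x2).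
Proof.
split=> [x2 | x1] c u v /=; first by rewrite pair_scalarr scalerDl scalerA.
by rewrite scalerDr !scalerA mulrC.
Qed.

Fact lact_is_linear y : linear (lact y).
Proof.
by move=> c u v; rewrite /lact linearP /= (tsum_is_linear (lact_bilin y)).
Qed.
HB.instance Definition _ y :=
  GRing.isLinear.Build k O_SUq2 O_SUq2 *:%R (lact y) (lact_is_linear y).

Fact ract_is_linear y : linear (ract^~ y).
Proof.
by move=> c u v; rewrite /ract linearP /= (tsum_is_linear (ract_bilin y)).
Qed.

Lemma lact_pure y x1 x2 :
  tsum (fun x1 x2 : O_SUq2 => P y x2 *: x1) (pure x1 x2) = P y x2 *: x1.
Proof. exact: (tsum_pure (lact_bilin y)). Qed.
Lemma ract_pure y x1 x2 :
  tsum (fun x1 x2 : O_SUq2 => P y x1 *: x2) (pure x1 x2) = P y x1 *: x2.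
Proof. exact: (tsum_pure (ract_bilin y)). Qed.

Section GroupLike.
Variable y : uq_su2.
Hypothesis y_grouplike : uq_comul y = pure y y.
Hypothesis y_counit : counit y = 1.

Fact grouplike_pairM x z : P y (x * z) = P y x * P y z.
Proof.
rewrite pair_mulr y_grouplike tsum_pure //.
split=> [y2 | y1] c u v; rewrite pair_scalarl.
  by rewrite mulrDl -mulrA.
by rewrite mulrDr mulrCA.
Qed.

Lemma lactM x z : lact y (x * z) = lact y x * lact y z.
Proof.
rewrite /lact rmorphM /=.
have L := tsum_is_linear (lact_bilin y); have fp := lact_pure y.
set f := tsum _ in L fp *.
have fD u v : f (u + v) = f u + f v by have := L 1 u v; rewrite !scale1r.
have f0 : f 0 = 0 by apply: (addrI (f 0)); rewrite -fD !addr0.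
elim/tens_ind: (suq_comul x) => [a b||u u' IH IH'].
- elim/tens_ind: (suq_comul z) => [a' b'||v v' IH IH'].
  + by rewrite pureM !fp grouplike_pairM -scalerAl -scalerAr scalerA.
  + by rewrite mulr0 f0 mulr0.
  + by rewrite mulrDr !fD IH IH' mulrDr.
- by rewrite mul0r f0 mul0r.
- by rewrite mulrDl !fD IH IH' mulrDl.
Qed.

Lemma ractM x z : ract (x * z) y = ract x y * ract z y.
Proof.
rewrite /ract rmorphM /=.
have L := tsum_is_linear (ract_bilin y); have fp := ract_pure y.
set f := tsum _ in L fp *.
have fD u v : f (u + v) = f u + f v by have := L 1 u v; rewrite !scale1r.
have f0 : f 0 = 0 by apply: (addrI (f 0)); rewrite -fD !addr0.
elim/tens_ind: (suq_comul x) => [a b||u u' IH IH'].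
- elim/tens_ind: (suq_comul z) => [a' b'||v v' IH IH'].
  + by rewrite pureM !fp grouplike_pairM -scalerAl -scalerAr scalerA.
  + by rewrite mulr0 f0 mulr0.
  + by rewrite mulrDr !fD IH IH' mulrDr.
- by rewrite mul0r f0 mul0r.
- by rewrite mulrDl !fD IH IH' mulrDl.
Qed.

Lemma lact1 : lact y 1 = 1.
Proof. by rewrite /lact rmorph1 -pure1 lact_pure pair_1r y_counit scale1r. Qed.
Lemma ract1 : ract 1 y = 1.
Proof. by rewrite /ract rmorph1 -pure1 ract_pure pair_1r y_counit scale1r. Qed.

End GroupLike.

Fact uK_grouplike : uq_comul uK = pure uK uK.
Proof. exact: plift_gen. Qed.
Fact uK_counit : counit uK = 1 :> k.
Proof. exact: counit_pgen. Qed.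
Fact uK2_grouplike : uq_comul (uK * uK) = pure (uK * uK) (uK * uK).
Proof. by rewrite [LHS]rmorphM /= uK_grouplike pureM. Qed.
Fact uK2_counit : counit (uK * uK) = 1 :> k.
Proof. by rewrite [LHS]rmorphM /= uK_counit mulr1. Qed.

Definition podles_pred : pred O_SUq2 := fun x => ract x uK == x.

Fact podles_closed : GRing.subsemialg_closed podles_pred.
Proof.
have lin := ract_is_linear uK.
have D u v : ract (u + v) uK = ract u uK + ract v uK.
  by have := lin 1 u v; rewrite !scale1r.
have r0 : ract 0 uK = 0 by apply: (addrI (ract 0 uK)); rewrite -D !addr0.
split.
- by rewrite unfold_in /podles_pred (ract1 uK_counit).
- split; first by rewrite unfold_in /podles_pred r0.
  by move=> u v; rewrite !unfold_in /podles_pred D => /eqP-> /eqP->.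
- move=> c u; rewrite !unfold_in /podles_pred => /eqP ru.
  by have := lin c u 0; rewrite r0 !addr0 ru => ->.
- move=> u v; rewrite !unfold_in /podles_pred (ractM uK_grouplike).
  by move=> /eqP-> /eqP->.
Qed.

(* The standard Podles sphere, a subalgebra of O_SUq2. *)
Record podles := Podles { podles_val :> O_SUq2; _ : podles_val \in podles_pred }.

HB.instance Definition _ := [isSub for podles_val].
HB.instance Definition _ := [Choice of podles by <:].
HB.instance Definition _ := GRing.SubChoice_isSubAlgebra.Build
  k O_SUq2 podles_pred podles podles_closed.

Fact suq_comul_gen g : suq_comul (pgen g) = suq_delta g.
Proof. exact: plift_gen. Qed.

Fact pair_suq_delta y z (g : suq_gen) : P (y * z) (pgen g) =
  tsum (X := k^o) (fun x1 x2 => P y x1 * P z x2) (suq_delta g).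
Proof. by rewrite pair_mull suq_comul_gen. Qed.

Fact pair_mul_gen y z (x1 x2 x3 x4 : O_SUq2) :
  tsum (X := k^o) (fun u v => P y u * P z v) (pure x1 x2 + pure x3 x4) =
    P y x1 * P z x2 + P y x3 * P z x4.
Proof.
have B : bilin (X := k^o) (fun u v => P y u * P z v).
  split=> [v | u] c u1 u2; rewrite pair_scalarr.
    by rewrite mulrDl -mulrA.
  by rewrite mulrDr mulrCA.
have := tsum_is_linear B 1 (pure x1 x2) (pure x3 x4).
by rewrite !scale1r !(tsum_pure B).
Qed.

Fact lact_gen y (x1 x2 x3 x4 : O_SUq2) :
  tsum (fun u v => P y v *: u) (pure x1 x2 + pure x3 x4) =
    P y x2 *: x1 + P y x4 *: x3.
Proof.
have := tsum_is_linear (lact_bilin y) 1 (pure x1 x2) (pure x3 x4).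
by rewrite !scale1r !lact_pure.
Qed.

Fact ract_gen y (x1 x2 x3 x4 : O_SUq2) :
  tsum (fun u v => P y u *: v) (pure x1 x2 + pure x3 x4) =
    P y x1 *: x2 + P y x3 *: x4.
Proof.
have := tsum_is_linear (ract_bilin y) 1 (pure x1 x2) (pure x3 x4).
by rewrite !scale1r !ract_pure.
Qed.

Fact pairK2 g :
  P (uK * uK) (pgen g) =
    match g with ga => s^-1 * s^-1 | gd => s * s | gb | gc => 0 end.
Proof.
by rewrite pair_suq_delta; case: g; rewrite pair_mul_gen !pair_gen; ring.
Qed.

Fact ract_lactK2 x :
  ract (lact (uK * uK) x) uK = lact (uK * uK) (ract x uK).
Proof.
have rlin := ract_is_linear uK; have llin := lact_is_linear (uK * uK).
have rD u v : ract (u + v) uK = ract u uK + ract v uK.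
  by have := rlin 1 u v; rewrite !scale1r.
have lD u v : lact (uK * uK) (u + v) = lact (uK * uK) u + lact (uK * uK) v.
  by have := llin 1 u v; rewrite !scale1r.
have r0 : ract 0 uK = 0 by apply: (addrI (ract 0 uK)); rewrite -rD !addr0.
have l0 : lact (uK * uK) 0 = 0.
  by apply: (addrI (lact (uK * uK) 0)); rewrite -lD !addr0.
have rZ c u : ract (c *: u) uK = c *: ract u uK.
  by have := rlin c u 0; rewrite r0 !addr0.
have lZ c u : lact (uK * uK) (c *: u) = c *: lact (uK * uK) u.
  by have := llin c u 0; rewrite l0 !addr0.
elim/presented_ind: x => [g||u v IHu IHv|u v IHu IHv|c u IHu].
- have lg : exists a, lact (uK * uK) (pgen g) = a *: pgen g.
    exists (P (uK * uK) (pgen (match g with ga | gc => ga | _ => gd end))).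
    by rewrite /lact suq_comul_gen; case: g;
       rewrite lact_gen !pairK2 !(scale0r, addr0, add0r).
  have rg : exists a, ract (pgen g) uK = a *: pgen g.
    exists (P uK (pgen (match g with ga | gb => ga | _ => gd end))).
    by rewrite /ract suq_comul_gen; case: g {lg};
       rewrite ract_gen !pair_gen !(scale0r, addr0, add0r).
  case: lg rg => [a lg] [b rg].
  by rewrite lg rg rZ lZ lg rg !scalerA mulrC.
- by rewrite (lact1 uK2_counit) (ract1 uK_counit) (lact1 uK2_counit).
- by rewrite lD rD IHu IHv rD lD.
- rewrite (lactM uK2_grouplike) !(ractM uK_grouplike) IHu IHv.
  by rewrite (lactM uK2_grouplike).
- by rewrite lZ rZ IHu rZ lZ.
Qed.

Fact podles_lactK2 (x : podles) : lact (uK * uK) x \in podles_pred.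
Proof.
rewrite unfold_in /podles_pred ract_lactK2.
by have := valP x; rewrite unfold_in /podles_pred => /eqP->.
Qed.

(* The restriction of sigma^-1 = K^2 to the Podles sphere. *)
Definition sigma_inv (x : podles) : podles := Podles (podles_lactK2 x).

Fact sigma_inv_is_linear : linear sigma_inv.
Proof. by move=> c x y; apply: val_inj; apply: lact_is_linear. Qed.
Fact sigma_inv_is_monoid_morphism : monoid_morphism sigma_inv.
Proof.
split; first by apply: val_inj; rewrite /= (lact1 uK2_counit).
by move=> x y; apply: val_inj; rewrite /= (lactM uK2_grouplike).
Qed.

HB.instance Definition _ := GRing.isLinear.Build k podles podles *:%R
  sigma_inv sigma_inv_is_linear.
HB.instance Definition _ := GRing.isMonoidMorphism.Build podles podles
  sigma_inv sigma_inv_is_monoid_morphism.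

End Actions.

End SUqComultiplication.

End QuantumGroups.

Arguments sigma_inv {k s s_neq0} P x.

Section TwistedCyclicCohomology.
Variables (k : fieldType) (A : algType k) (theta : {lrmorphism A -> A}).

(* An n-cochain, i.e., a linear functional on the (n+1)-fold tensor power of A,
   is represented by the corresponding multilinear function of n+1 arguments. *)
Definition tset n (a : n.-tuple A) (i : 'I_n) (x : A) : n.-tuple A :=
  [tuple if j == i then x else tnth a j | j < n].

Definition multilinear n (phi : n.-tuple A -> k) : Prop :=
  forall (a : n.-tuple A) (i : 'I_n) (c : k) (x y : A),
    phi (tset a i (c *: x + y)) = c * phi (tset a i x) + phi (tset a i y).

(* (a_0, ..., a_n) |-> (theta a_n, a_0, ..., a_(n-1)) *)
Definition twisted_rot n (a : n.+1.-tuple A) : n.+1.-tuple A :=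
  [tuple if j == ord0 then theta (tnth a ord_max) else tnth a (inord j.-1)
   | j < n.+1].

(* (a_0, ..., a_(n+1)) |-> (a_0, ..., a_i a_(i+1), ..., a_(n+1)) *)
Definition face n (i : 'I_n.+1) (a : n.+2.-tuple A) : n.+1.-tuple A :=
  [tuple if (j < i)%N then tnth a (widen_ord (leqnSn _) j)
         else if j == i
              then tnth a (widen_ord (leqnSn _) j) * tnth a (lift ord0 j)
              else tnth a (lift ord0 j)
   | j < n.+1].

(* (a_0, ..., a_(n+1)) |-> (theta a_(n+1) a_0, a_1, ..., a_n) *)
Definition twisted_face n (a : n.+2.-tuple A) : n.+1.-tuple A :=
  [tuple if j == ord0 then theta (tnth a ord_max) * tnth a ord0
         else tnth a (widen_ord (leqnSn _) j)
   | j < n.+1].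

Definition hochschild n (phi : n.+1.-tuple A -> k) (a : n.+2.-tuple A) : k :=
  \sum_(i < n.+1) (-1) ^+ i * phi (face i a)
  + (-1) ^+ n.+1 * phi (twisted_face a).

Definition cyclic_cochain n (phi : n.+1.-tuple A -> k) : Prop :=
  multilinear phi /\ forall a, phi a = (-1) ^+ n * phi (twisted_rot a).

Definition cyclic_cocycle n (phi : n.+1.-tuple A -> k) : Prop :=
  cyclic_cochain phi /\ forall a, hochschild phi a = 0.

Definition cyclic_coboundary n : (n.+1.-tuple A -> k) -> Prop :=
  match n with
  | 0 => fun phi => forall a, phi a = 0
  | m.+1 => fun phi => exists psi : m.+1.-tuple A -> k,
      cyclic_cochain psi /\ forall a, phi a = hochschild psi a
  end.

(* phi is a cocycle whose class in HC^n_theta(A) is nonzero. *)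
Definition nontrivial_cyclic_cocycle n (phi : n.+1.-tuple A -> k) : Prop :=
  cyclic_cocycle phi /\ ~ cyclic_coboundary phi.

End TwistedCyclicCohomology.

(* Main.v *)
Require Import Defs.
From HB Require Import structures.
From mathcomp Require Import all_boot all_order all_algebra.
From mathcomp Require Import ring.
Import GRing.Theory.

(** The functional tau is a Hochschild cocycle for formal reasons.  In

      h(x0 KF(x1) EK^3(x2)),  h(x0 EK(x1) K^3F(x2)),  h(x0 x1 K^4(x2))

    the operators acting on x1 and x2 are twisted derivations or automorphisms
    ([lactKF_mul], [lactEK3_mul], [lactEK_mul], [lactK3F_mul], [lactK4_mul]),
    so that all terms of b tau telescope except for two outer ones, and these
    cancel by the modular property h(K^2(x) y) = h(y K^4(x)) of the Haar state
    ([haar_K2C]).  Each of the three functionals is thus a cocycle; cyclicity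
    comes from their combination.  Rotating the first two and integrating by
    parts exchanges them up to sign and up to terms in which EK^2F - q^-2 KFEK acts on x1; this element is
    (q^3 - q)^-1 (K^4 - 1) by the relation for EF - FE ([uq_EKKF]), and the
    third functional absorbs exactly that ([tau3_cyclic]).

    The modular property on all of O(SU_q(2)) says that
    h(x y) = h(y theta(x)), where theta(x) is x acted on by K^2 from both
    sides ([haar_KMS]).  Since theta is multiplicative, it is enough to treat
    x = a, b, c, d.  The generators b and c are normal:
    b y = nu(y) b and c y = nu(y) c for the automorphism nu given by the
    action of K from both sides.  Since h is nu-invariant and nu fixes b and
    c, this gives the cases of b and c; applying the invariance of h under F
    and E to them gives those of a and d.

    For nontriviality tau is paired with a twisted cyclic 2-cycle.  Because
    a d - q b c = 1, the matrix e_ij = u_i v_j with u = (d, -q c) and v = (a, b)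
    is an idempotent over the Podles sphere, and K^2 acts on it as conjugation
    by diag(q^2, 1) =: diag(r_i).  For every idempotent of this kind the chain
    sum r_i e_ij (x) e_jl (x) e_li is a cycle modulo twisted rotations, whence
    it is annihilated by coboundaries of cyclic cochains
    ([hochschild_idempotent]).  On the other hand, the values of h on b c and
    (b c)^2, which follow from the modular property, show that tau takes the
    value q / (1 - q^2) on it ([tau3_proj]). *)

Set Implicit Arguments.
Unset Strict Implicit.
Unset Printing Implicit Defensive.

Local Open Scope ring_scope.

(** * Twisted cyclic cochains of low degree *)

Section LowDegree.
Variables (k : fieldType) (A : algType k) (theta : {lrmorphism A -> A}).

Lemma tuple3P (t : 3.-tuple A) : exists x y z, t = [tuple x; y; z].
Proof.
case/tupleP: t => x t; case/tupleP: t => y t; case/tupleP: t => z t.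
by exists x, y, z; rewrite tuple0; apply: val_inj.
Qed.

Lemma tuple4P (t : 4.-tuple A) : exists x y z w, t = [tuple x; y; z; w].
Proof.
case/tupleP: t => x t; case: (tuple3P t) => y [z] [w] ->.
by exists x, y, z, w; apply: val_inj.
Qed.

Lemma hochschild1E (psi : 2.-tuple A -> k) x y z :
  hochschild theta psi [tuple x; y; z] =
  psi [tuple x * y; z] - psi [tuple x; y * z] + psi [tuple theta z * x; y].
Proof.
rewrite /hochschild !big_ord_recl big_ord0 addr0 expr0 mul1r expr1 mulN1r.
rewrite -signr_odd expr0 mul1r.
congr (psi _ - psi _ + psi _); apply: eq_from_tnth => -[[|[|//]] lt_i2];
  by rewrite tnth_mktuple /= !(tnth_nth 0).
Qed.

Lemma hochschild2E (phi : 3.-tuple A -> k) x y z w :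
  hochschild theta phi [tuple x; y; z; w] =
  phi [tuple x * y; z; w] - phi [tuple x; y * z; w] + phi [tuple x; y; z * w]
  - phi [tuple theta w * x; y; z].
Proof.
rewrite /hochschild !big_ord_recl big_ord0 addr0 expr0 mul1r.
rewrite /bump /= !(exprS, expr0, mulr1, mulN1r, mulNr, opprK, mul1r) !addrA.
congr (phi _ - phi _ + phi _ - phi _);
  apply: eq_from_tnth => -[[|[|[|//]]] lt_i3];
  by rewrite tnth_mktuple /= !(tnth_nth 0).
Qed.

Lemma twisted_rot2E x y z : twisted_rot theta [tuple x; y; z] = [tuple theta z; x; y].
Proof.
apply: eq_from_tnth => -[[|[|[|//]]] lt_i3];
  by rewrite tnth_mktuple /= !(tnth_nth 0) //= inordK.
Qed.

Lemma twisted_rot1E x y : twisted_rot theta [tuple x; y] = [tuple theta y; x].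
Proof.
apply: eq_from_tnth => -[[|[|//]] lt_i3];
  by rewrite tnth_mktuple /= !(tnth_nth 0) //= inordK.
Qed.

Lemma multilinear2P (psi : 2.-tuple A -> k) : multilinear psi ->
  (forall y, scalar (fun x => psi [tuple x; y])) /\
  (forall x, scalar (fun y => psi [tuple x; y])).
Proof.
move=> ml; have e0 x y z : tset [tuple x; y] ord0 z = [tuple z; y].
  apply: eq_from_tnth => -[[|[|//]] lt_i2];
    by rewrite tnth_mktuple /= !(tnth_nth 0).
have e1 x y z : tset [tuple x; y] ord_max z = [tuple x; z].
  apply: eq_from_tnth => -[[|[|//]] lt_i2];
    by rewrite tnth_mktuple /= !(tnth_nth 0).
split=> [y | x] r u v.
  by have := ml [tuple 0; y] ord0 r u v; rewrite !e0.
by have := ml [tuple x; 0] ord_max r u v; rewrite !e1.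
Qed.

Section Idempotent.
Variables (I : finType) (e : I -> I -> A) (r : I -> k).
Hypothesis e_idem : forall i l, \sum_j e i j * e j l = e i l.
Hypothesis e_theta : forall i j, r j *: theta (e i j) = r i *: e i j.
Hypothesis two_neq0 : 2%:R != 0 :> k.

(** The family e is an idempotent matrix on which theta acts as conjugation by
    diag(r).  The first two faces of the chain sum r_i e_ij (x) e_jl (x) e_li give
    the same 1-chain with opposite signs; so does, up to relabelling, the
    twisted third one, by the choice of the weights r_i.  The remaining value T
    of psi equals -T by cyclicity. *)
Lemma hochschild_idempotent (psi : 2.-tuple A -> k) : cyclic_cochain theta psi ->
  \sum_i \sum_j \sum_l r i * hochschild theta psi [tuple e i j; e j l; e l i] = 0.
Proof.
move=> [ml cyc]; have [psil psir] := multilinear2P ml.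
pose f (x : A) (y : A) := psi [tuple x; y].
have fDl y : {morph f^~ y : u v / u + v}.
  by move=> u v; have := psil y 1 u v; rewrite scale1r mul1r.
have fDr x : {morph f x : u v / u + v}.
  by move=> u v; have := psir x 1 u v; rewrite scale1r mul1r.
have f0l y : f 0 y = 0 by apply: (addrI (f 0 y)); rewrite -fDl !addr0.
have f0r x : f x 0 = 0 by apply: (addrI (f x 0)); rewrite -fDr !addr0.
have fZl s u y : f (s *: u) y = s * f u y.
  by have := psil y s u 0; rewrite -!/(f _ _) f0l !addr0.
have fC x y : f x y = - f (theta y) x.
  by rewrite /f cyc twisted_rot1E expr1 mulN1r.
pose T := \sum_i \sum_l r i * f (e i l) (e l i).
have T0 : T = 0.
  have TN : T = - T.
    rewrite {2}/T exchange_big -sumrN; apply: eq_bigr => i _.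
    rewrite -sumrN; apply: eq_bigr => l _.
    by rewrite fC mulrN -!fZl e_theta.
  apply/eqP; rewrite -(mulrI_eq0 _ (mulfI two_neq0)) mulr_natl mulr2n {2}TN.
  by rewrite subrr.
have sumf (J : finType) (F : J -> A) y : f (\sum_j F j) y = \sum_j f (F j) y.
  exact: (big_morph _ (fDl y) (f0l y)).
have sumfr (J : finType) (F : J -> A) x : f x (\sum_j F j) = \sum_j f x (F j).
  exact: (big_morph _ (fDr x) (f0r x)).
transitivity (\sum_i \sum_j \sum_l r i * f (e i j * e j l) (e l i)
  - \sum_i \sum_j \sum_l r i * f (e i j) (e j l * e l i)
  + \sum_i \sum_j \sum_l r i * f (theta (e l i) * e i j) (e j l)).
  do 3 (rewrite -sumrB -big_split /=; apply: eq_bigr => ? _).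
  by rewrite hochschild1E /f; ring.
have -> : \sum_i \sum_j \sum_l r i * f (e i j * e j l) (e l i) = T.
  apply: eq_bigr => i _; rewrite exchange_big; apply: eq_bigr => l _.
  by rewrite -mulr_sumr -sumf e_idem.
have -> : \sum_i \sum_j \sum_l r i * f (e i j) (e j l * e l i) = T.
  apply: eq_bigr => i _; apply: eq_bigr => j _.
  by rewrite -mulr_sumr -sumfr e_idem.
have -> : \sum_i \sum_j \sum_l r i * f (theta (e l i) * e i j) (e j l) = T.
  transitivity (\sum_i \sum_j \sum_l r l * f (e l i * e i j) (e j l)).
    do 3 (apply: eq_bigr => ? _).
    by rewrite -!fZl !scalerAl e_theta.
  rewrite exchange_big [RHS]exchange_big; apply: eq_bigr => j _.
  rewrite exchange_big; apply: eq_bigr => l _.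
  by rewrite -mulr_sumr -sumf e_idem.
by rewrite subrr add0r T0.
Qed.
End Idempotent.
End LowDegree.

(** * The left action of U_q(su_2) *)

Section Tsum.
Variables (k : fieldType) (V W X : lmodType k).

Lemma tsumD (beta : V -> W -> X) t u : bilin beta ->
  tsum beta (t + u) = tsum beta t + tsum beta u.
Proof. by move=> B; have := tsum_is_linear B 1 t u; rewrite !scale1r. Qed.

Lemma tsum0 (beta : V -> W -> X) : bilin beta -> tsum beta 0 = 0.
Proof. by move=> B; rewrite (tsum_tclass B) big_nil. Qed.

End Tsum.

Section PodlesCocycle.
Variables (k : fieldType) (s : k) (s_neq0 : s != 0) (P : dual_pairing s_neq0).
Local Notation q := (s ^+ 2).
Local Notation O := (O_SUq2 s).
Local Notation U := (uq_su2 s).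
Local Notation a := (oa s).
Local Notation b := (ob s).
Local Notation c := (oc s).
Local Notation d := (od s).
Local Notation E := (uE s).
Local Notation F := (uF s).
Local Notation K := (uK s).
Local Notation Ki := (uKi s).
Local Notation "y |> x" := (lact P y x) (at level 38, right associativity).

Lemma lact_linearl x : linear (fun y : U => y |> x).
Proof.
move=> r y z; rewrite /lact /tsum scaler_sumr -big_split /=.
by apply: eq_bigr => p _; rewrite pair_scalarl scalerDl scalerA.
Qed.

Lemma lactDl y z x : (y + z) |> x = y |> x + z |> x.
Proof. by have := lact_linearl x 1 y z; rewrite !scale1r. Qed.

Lemma lact0l x : 0 |> x = 0.
Proof. by apply: (addrI (0 |> x)); rewrite -lactDl !addr0. Qed.

Lemma lactZl r y x : (r *: y) |> x = r *: (y |> x).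
Proof. by have := lact_linearl x r y 0; rewrite lact0l !addr0. Qed.

Lemma lactD y (x z : O) : y |> (x + z) = y |> x + y |> z.
Proof. exact: (raddfD (lact P y)). Qed.

Lemma lactZ y r (x : O) : y |> (r *: x) = r *: (y |> x).
Proof. exact: (linearZZ (lact P y)). Qed.

Lemma leibniz_bilin (x z : O) : bilin (fun y1 y2 : U => (y1 |> x) * (y2 |> z)).
Proof.
split=> [y2 | y1] r y y' /=; rewrite lactDl lactZl.
  by rewrite mulrDl scalerAl.
by rewrite mulrDr scalerAr.
Qed.

(** The module algebra axiom y(x z) = y_(1)(x) y_(2)(z), dual to the
    multiplicativity of the coproduct of O(SU_q(2)). *)
Lemma lact_leibniz y (x z : O) :
  y |> (x * z) = tsum (fun y1 y2 => (y1 |> x) * (y2 |> z)) (uq_comul y).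
Proof.
rewrite /lact [suq_comul _ (x * z)]rmorphM /=.
pose f (t : tens O O) y' := tsum (fun u v : O => P y' v *: u) t.
rewrite -[LHS]/(f (suq_comul s_neq0 x * suq_comul s_neq0 z) y).
rewrite -[RHS]/(tsum (fun y1 y2 => f (suq_comul s_neq0 x) y1 *
  f (suq_comul s_neq0 z) y2) (uq_comul y)).
have fD t t' y' : f (t + t') y' = f t y' + f t' y'.
  exact: tsumD (lact_bilin P y').
have f0 y' : f 0 y' = 0 by exact: tsum0 (lact_bilin P y').
have fp u v y' : f (pure u v) y' = P y' v *: u by exact: lact_pure.
elim/tens_ind: (suq_comul s_neq0 x) => [u v||t t' IH IH'].
- elim/tens_ind: (suq_comul s_neq0 z) => [u' v'||t t' IH IH'].
  + rewrite pureM fp pair_mulr scaler_suml; apply: eq_bigr => p _.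
    by rewrite !fp -scalerAl -scalerAr scalerA.
  + by rewrite mulr0 f0 [RHS]big1 // => p _; rewrite f0 mulr0.
  + rewrite mulrDr fD IH IH' -big_split; apply: eq_bigr => p _.
    by rewrite fD mulrDr.
- by rewrite mul0r f0 [RHS]big1 // => p _; rewrite f0 mul0r.
- rewrite mulrDl fD IH IH' -big_split; apply: eq_bigr => p _.
  by rewrite fD mulrDl.
Qed.

Lemma lact_a y : y |> a = P y a *: a + P y c *: b.
Proof. by rewrite /lact suq_comul_gen lact_gen. Qed.
Lemma lact_b y : y |> b = P y b *: a + P y d *: b.
Proof. by rewrite /lact suq_comul_gen lact_gen. Qed.
Lemma lact_c y : y |> c = P y a *: c + P y c *: d.
Proof. by rewrite /lact suq_comul_gen lact_gen. Qed.
Lemma lact_d y : y |> d = P y b *: c + P y d *: d.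
Proof. by rewrite /lact suq_comul_gen lact_gen. Qed.

Lemma lact_gen_mul y z (g : suq_gen) : (y * z) |> pgen g = y |> z |> pgen g.
Proof.
by case: g; rewrite ?(lact_a, lact_b, lact_c, lact_d) !lactD !lactZ
   ?(lact_a, lact_b, lact_c, lact_d) !pair_suq_delta !pair_mul_gen;
   lincomb k; ring.
Qed.

(** Induction on x instead of coassociativity: the action on the generators is
    a matrix product, and the Leibniz rule carries the identity over to
    products of elements x because the coproduct of U_q(su_2) is
    multiplicative. *)
Lemma lact_comp y z x : (y * z) |> x = y |> z |> x.
Proof.
elim/presented_ind: x y z => [g||x x' IH IH'|x x' IH IH'|r x IH] y z.
- exact: lact_gen_mul.
- have l1 y' : y' |> 1 = counit y' *: 1.
    by rewrite /lact rmorph1 -pure1 lact_pure pair_1r.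
  by rewrite !l1 rmorphM lactZ l1 scalerA mulrC.
- by rewrite !lactD IH IH'.
- rewrite (lact_leibniz z) {1}/tsum raddf_sum lact_leibniz /uq_comul rmorphM /=.
  pose L t := tsum (fun y1 y2 : U => (y1 |> (x : O)) * (y2 |> (x' : O))) t.
  rewrite -[LHS]/(L (uq_comul y * uq_comul z)).
  pose R t' (p : U * U) :=
    tsum (fun y1 y2 => (y1 |> p.1 |> (x : O)) * (y2 |> p.2 |> (x' : O))) t'.
  transitivity (\sum_(p <- trepr (uq_comul z)) R (uq_comul y) p); last first.
    by apply: eq_bigr => p _; rewrite lact_leibniz.
  have LB := leibniz_bilin x x'.
  rewrite [in LHS](tensE (uq_comul z)) mulr_sumr.
  have LD u v : L (u + v) = L u + L v by exact: tsumD.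
  have L0 : L 0 = 0 by exact: tsum0.
  rewrite (big_morph L LD L0); apply: eq_bigr => p _.
  have RB := leibniz_bilin (p.1 |> (x : O)) (p.2 |> (x' : O)).
  elim/tens_ind: (uq_comul y) => [u v||t t' Ht Ht'].
  + by rewrite pureM /L /R !tsum_pure // IH IH'.
  + by rewrite mul0r L0 /R tsum0.
  + by rewrite mulrDl LD Ht Ht' /R tsumD.
- by rewrite !lactZ IH.
Qed.

Lemma lact_leibniz_pure y y1 y2 y3 y4 (x z : O) :
  uq_comul y = pure y1 y2 + pure y3 y4 ->
  y |> (x * z) = (y1 |> x) * (y2 |> z) + (y3 |> x) * (y4 |> z).
Proof.
by move=> e; rewrite lact_leibniz e tsumD ?tsum_pure //; apply: leibniz_bilin.
Qed.

Lemma lact_1l x : 1 |> x = x.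
Proof.
have comul1 : uq_comul (1 : U) = pure 1 1 by rewrite [LHS]rmorph1.
have counit1 : counit (1 : U) = 1 by rewrite rmorph1.
have fix1 g : 1 |> (pgen g : O) = pgen g.
  by case: g; rewrite ?(lact_a, lact_b, lact_c, lact_d) !pair_1l !counit_pgen
    !(scale1r, scale0r, addr0, add0r).
elim/presented_ind: x => [g||x z IH IH'|x z IH IH'|r x IH].
- exact: fix1.
- exact: lact1.
- by rewrite lactD IH IH'.
- by rewrite (lactM P comul1) IH IH'.
- by rewrite lactZ IH.
Qed.

Lemma lact_KKi x : K |> Ki |> x = x.
Proof. by rewrite -lact_comp uq_KKi lact_1l. Qed.
Lemma lact_KiK x : Ki |> K |> x = x.
Proof. by rewrite -lact_comp uq_KiK lact_1l. Qed.

Lemma lactK_mul (x z : O) : K |> (x * z) = (K |> x) * (K |> z).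
Proof. exact: (lactM P (uK_grouplike s)). Qed.
Lemma lactE_mul (x z : O) :
  E |> (x * z) = (E |> x) * (K |> z) + (Ki |> x) * (E |> z).
Proof. by apply: lact_leibniz_pure; exact: plift_gen. Qed.
Lemma lactF_mul (x z : O) :
  F |> (x * z) = (F |> x) * (K |> z) + (Ki |> x) * (F |> z).
Proof. by apply: lact_leibniz_pure; exact: plift_gen. Qed.

Let gen_simp := (scale1r, scale0r, addr0, add0r).
Lemma lactK_a : K |> a = s^-1 *: a.
Proof. by rewrite lact_a !pair_gen !gen_simp. Qed.
Lemma lactK_b : K |> b = s *: b.
Proof. by rewrite lact_b !pair_gen !gen_simp. Qed.
Lemma lactK_c : K |> c = s^-1 *: c.
Proof. by rewrite lact_c !pair_gen !gen_simp. Qed.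
Lemma lactK_d : K |> d = s *: d.
Proof. by rewrite lact_d !pair_gen !gen_simp. Qed.
Lemma lactKi_b : Ki |> b = s^-1 *: b.
Proof. by rewrite lact_b !pair_gen !gen_simp. Qed.
Lemma lactKi_c : Ki |> c = s *: c.
Proof. by rewrite lact_c !pair_gen !gen_simp. Qed.
Lemma lactE_a : E |> a = b.
Proof. by rewrite lact_a !pair_gen !gen_simp. Qed.
Lemma lactE_b : E |> b = 0.
Proof. by rewrite lact_b !pair_gen !gen_simp. Qed.
Lemma lactE_c : E |> c = d.
Proof. by rewrite lact_c !pair_gen !gen_simp. Qed.
Lemma lactE_d : E |> d = 0.
Proof. by rewrite lact_d !pair_gen !gen_simp. Qed.
Lemma lactF_a : F |> a = 0.
Proof. by rewrite lact_a !pair_gen !gen_simp. Qed.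
Lemma lactF_b : F |> b = a.
Proof. by rewrite lact_b !pair_gen !gen_simp. Qed.
Lemma lactF_c : F |> c = 0.
Proof. by rewrite lact_c !pair_gen !gen_simp. Qed.
Lemma lactF_d : F |> d = c.
Proof. by rewrite lact_d !pair_gen !gen_simp. Qed.

(** * The right action of K *)

Local Notation "x <| y" := (ract P x y) (at level 37, left associativity).

Lemma ractD (x z : O) y : (x + z) <| y = x <| y + z <| y.
Proof. by have := ract_is_linear P y 1 x z; rewrite !scale1r. Qed.
Lemma ractZ r (x : O) y : (r *: x) <| y = r *: (x <| y).
Proof.
have r0 : 0 <| y = 0 by apply: (addrI (0 <| y)); rewrite -ractD !addr0.
by have := ract_is_linear P y r x 0; rewrite r0 !addr0.
Qed.
Lemma ract_a y : a <| y = P y a *: a + P y b *: c.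
Proof. by rewrite /ract suq_comul_gen ract_gen. Qed.
Lemma ract_b y : b <| y = P y a *: b + P y b *: d.
Proof. by rewrite /ract suq_comul_gen ract_gen. Qed.
Lemma ract_c y : c <| y = P y c *: a + P y d *: c.
Proof. by rewrite /ract suq_comul_gen ract_gen. Qed.
Lemma ract_d y : d <| y = P y c *: b + P y d *: d.
Proof. by rewrite /ract suq_comul_gen ract_gen. Qed.
Lemma ractK_a : a <| K = s^-1 *: a.
Proof. by rewrite ract_a !pair_gen !gen_simp. Qed.
Lemma ractK_b : b <| K = s^-1 *: b.
Proof. by rewrite ract_b !pair_gen !gen_simp. Qed.
Lemma ractK_c : c <| K = s *: c.
Proof. by rewrite ract_c !pair_gen !gen_simp. Qed.
Lemma ractK_d : d <| K = s *: d.
Proof. by rewrite ract_d !pair_gen !gen_simp. Qed.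
Lemma ractK_mul (x z : O) : (x * z) <| K = (x <| K) * (z <| K).
Proof. exact: (ractM P (uK_grouplike s)). Qed.

(** * Relations in U_q(su_2) and twisted Leibniz rules *)

Lemma q_neq0 : q != 0.
Proof. exact: expf_neq0. Qed.

Lemma uq_EK : E * K = q^-1 *: (K * E).
Proof. by rewrite uq_KE scalerA mulVf ?q_neq0 // scale1r. Qed.

Lemma q2_neq0 : q ^+ 2 != 0.
Proof. by rewrite expf_neq0 ?q_neq0. Qed.

Lemma uq_KnE n : K ^+ n * E = q ^+ n *: (E * K ^+ n).
Proof.
elim: n => [|n IH]; first by rewrite !expr0 scale1r mul1r mulr1.
rewrite (exprS K) -mulrA IH -scalerAr (mulrA K E) uq_KE -scalerAl.
by rewrite scalerA -exprSr !mulrA.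
Qed.

Lemma uq_FKn n : F * K ^+ n = q ^+ n *: (K ^+ n * F).
Proof.
elim: n => [|n IH]; first by rewrite !expr0 scale1r mul1r mulr1.
rewrite (exprSr K) (mulrA F) IH -scalerAl -(mulrA _ F K) uq_FK -scalerAr.
by rewrite scalerA -(exprSr q) (mulrA _ K F).
Qed.

Lemma uq_K2EK : K ^+ 2 * (E * K) = q ^+ 2 *: (E * K ^+ 3).
Proof. by rewrite mulrA uq_KnE -scalerAl -mulrA -exprSr. Qed.

Lemma uq_KFK2 : K * F * K ^+ 2 = q ^+ 2 *: (K ^+ 3 * F).
Proof. by rewrite -mulrA uq_FKn -scalerAr mulrA -exprS. Qed.

Lemma uq_EKK2 : E * K * K ^+ 2 = E * K ^+ 3.
Proof. by rewrite -mulrA -exprS. Qed.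

(** The commutation relation that makes the third summand of tau compensate the
    failure of cyclicity of the first two. *)
Lemma uq_EKKF : E * K * (K * F) =
  q ^- 2 *: (K * F * (E * K)) + (q ^+ 3 - q)^-1 *: (K ^+ 4 - 1).
Proof.
have -> : K * F * (E * K) = K ^+ 2 * (F * E).
  rewrite uq_EK -scalerAr -!mulrA (mulrA F) uq_FK -scalerAl -scalerAr scalerA.
  by rewrite mulVf ?q_neq0 // scale1r !mulrA.
have -> : E * K * (K * F) = q ^- 2 *: (K ^+ 2 * (E * F)).
  by rewrite !mulrA uq_KnE -!scalerAl scalerK ?q2_neq0 // (expr2 K) !mulrA.
have -> : K ^+ 4 - 1 = K ^+ 2 * (K * K - Ki * Ki).
  rewrite mulrBr -[K * K]expr2 -exprD (expr2 K) -mulrA (mulrA K Ki).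
  by rewrite uq_KKi mul1r uq_KKi.
apply/eqP; rewrite addrC -subr_eq -scalerBr -mulrBr uq_EF -scalerAr scalerA.
apply/eqP; congr (_ *: _); rewrite -invfM; congr (_^-1).
by field.
Qed.

Lemma lactK2_mul (x z : O) : K ^+ 2 |> (x * z) = (K ^+ 2 |> x) * (K ^+ 2 |> z).
Proof. exact: (lactM P (uK2_grouplike s)). Qed.
Lemma lactK4_mul (x z : O) : K ^+ 4 |> (x * z) = (K ^+ 4 |> x) * (K ^+ 4 |> z).
Proof. by rewrite (exprD K 2 2) (lact_comp (K ^+ 2)) !lactK2_mul -!lact_comp. Qed.
Lemma lactKF_mul (x z : O) :
  (K * F) |> (x * z) = ((K * F) |> x) * (K ^+ 2 |> z) + x * ((K * F) |> z).
Proof.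
by rewrite !lact_comp lactF_mul lactD !lactK_mul lact_KKi.
Qed.
Lemma lactEK_mul (x z : O) :
  (E * K) |> (x * z) = ((E * K) |> x) * (K ^+ 2 |> z) + x * ((E * K) |> z).
Proof.
by rewrite !lact_comp lactK_mul lactE_mul lact_KiK.
Qed.
Lemma lactEK3_mul (x z : O) : (E * K ^+ 3) |> (x * z) =
  ((E * K ^+ 3) |> x) * (K ^+ 4 |> z) + (K ^+ 2 |> x) * ((E * K ^+ 3) |> z).
Proof.
by rewrite -uq_EKK2 lact_comp lactK2_mul lactEK_mul -!lact_comp -exprD.
Qed.
Lemma lactK3F_mul (x z : O) : (K ^+ 3 * F) |> (x * z) =
  ((K ^+ 3 * F) |> x) * (K ^+ 4 |> z) + (K ^+ 2 |> x) * ((K ^+ 3 * F) |> z).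
Proof.
rewrite exprSr -mulrA !(lact_comp (K ^+ 2)) lactKF_mul lactD !lactK2_mul.
by rewrite -!lact_comp -exprD.
Qed.

Lemma lactK4E x : K ^+ 4 |> x = K |> K |> K |> K |> x.
Proof. by rewrite -!lact_comp -!mulrA. Qed.

(** * The modular property of the Haar state *)

Definition nu x := K |> (x <| K).

Lemma nuM : {morph nu : x z / x * z}.
Proof. by move=> x z; rewrite /nu ractK_mul lactK_mul. Qed.
Lemma nuD : {morph nu : x z / x + z}.
Proof. by move=> x z; rewrite /nu ractD lactD. Qed.
Lemma nuZ r x : nu (r *: x) = r *: nu x.
Proof. by rewrite /nu ractZ lactZ. Qed.
Lemma nu1 : nu 1 = 1.
Proof. by rewrite /nu (ract1 P (uK_counit s)) (lact1 P (uK_counit s)). Qed.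
Lemma nu_a : nu a = q^-1 *: a.
Proof. by rewrite /nu ractK_a lactZ lactK_a scalerA; congr (_ *: _); field. Qed.
Lemma nu_b : nu b = b.
Proof. by rewrite /nu ractK_b lactZ lactK_b scalerA mulVf // scale1r. Qed.
Lemma nu_c : nu c = c.
Proof. by rewrite /nu ractK_c lactZ lactK_c scalerA mulfV // scale1r. Qed.
Lemma nu_d : nu d = q *: d.
Proof. by rewrite /nu ractK_d lactZ lactK_d scalerA. Qed.

(** It is enough to check normality on generators because nu is
    multiplicative. *)
Lemma normal_from_gens (g : O) :
  (forall i, g * pgen i = nu (pgen i) * g) -> forall x, g * x = nu x * g.
Proof.
move=> Hg x; elim/presented_ind: x => [i||x z IH IH'|x z IH IH'|r x IH].
- exact: Hg.
- by rewrite nu1 mul1r mulr1.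
- by rewrite nuD mulrDl mulrDr IH IH'.
- by rewrite nuM mulrA IH -mulrA IH' mulrA.
- by rewrite nuZ -scalerAl -scalerAr IH.
Qed.

Lemma normal_b x : b * x = nu x * b.
Proof.
apply: normal_from_gens x => -[]; rewrite ?(nu_a, nu_b, nu_c, nu_d) -?scalerAl.
- by rewrite suq_ab scalerA mulVf ?q_neq0 // scale1r.
- by [].
- exact: suq_bc.
- exact: suq_bd.
Qed.

Lemma normal_c x : c * x = nu x * c.
Proof.
apply: normal_from_gens x => -[]; rewrite ?(nu_a, nu_b, nu_c, nu_d) -?scalerAl.
- by rewrite suq_ac scalerA mulVf ?q_neq0 // scale1r.
- exact/esym/suq_bc.
- by [].
- exact: suq_cd.
Qed.

Lemma pairDr y : {morph P y : u v / u + v}.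
Proof.
by move=> u v; have := pair_scalarr P y 1 u v; rewrite scale1r mul1r.
Qed.
Lemma pair0r y : P y 0 = 0.
Proof. by apply: (addrI (P y 0)); rewrite -pairDr !addr0. Qed.
Lemma pairZr y r u : P y (r *: u) = r * P y u.
Proof. by have := pair_scalarr P y r u 0; rewrite pair0r !addr0. Qed.

Section Haar.
Variables (h : {scalar O}) (h_haar : is_haar s_neq0 h).

Lemma haarZ r x : h (r *: x) = r * h x.
Proof. exact: linearZ_LR. Qed.
Lemma haarD x z : h (x + z) = h x + h z.
Proof. exact: raddfD. Qed.
Lemma haar0 : h 0 = 0.
Proof. exact: raddf0. Qed.
Lemma haarN x : h (- x) = - h x.
Proof. exact: raddfN. Qed.

Lemma haar_lact y x : h (y |> x) = counit y * h x.
Proof.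
have [_ _ /(_ x)/(congr1 (P y))] := h_haar.
rewrite pairZr pair_1r mulrC => <-; rewrite /lact /tsum (big_morph h haarD haar0).
rewrite (big_morph _ (pairDr y) (pair0r y)).
by apply: eq_bigr => p _; rewrite haarZ pairZr mulrC.
Qed.

Lemma haar_ract y x : h (x <| y) = counit y * h x.
Proof.
have [_ /(_ x)/(congr1 (P y)) + _] := h_haar.
rewrite pairZr pair_1r mulrC => <-; rewrite /ract /tsum (big_morph h haarD haar0).
rewrite (big_morph _ (pairDr y) (pair0r y)).
by apply: eq_bigr => p _; rewrite haarZ pairZr mulrC.
Qed.

Lemma haar_K x : h (K |> x) = h x.
Proof. by rewrite haar_lact uK_counit mul1r. Qed.
Lemma haar_E x : h (E |> x) = 0.
Proof. by rewrite haar_lact counit_pgen mul0r. Qed.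
Lemma haar_F x : h (F |> x) = 0.
Proof. by rewrite haar_lact counit_pgen mul0r. Qed.
Lemma haar_nu x : h (nu x) = h x.
Proof. by rewrite haar_K haar_ract uK_counit mul1r. Qed.

(** As b is normal, h(b y) = h(nu(y) b) = h(nu(y b)) = h(y b). *)
Lemma haar_bC x : h (b * x) = h (x * b).
Proof. by rewrite normal_b -{1}nu_b -nuM haar_nu. Qed.
Lemma haar_cC x : h (c * x) = h (x * c).
Proof. by rewrite normal_c -{1}nu_c -nuM haar_nu. Qed.

(** Since E(c) = d and h vanishes on the image of E, the two values
    h(E(c y)) = 0 and h(E(y c)) = 0 express h(d y') and h(y' d) in terms of
    h(c E(y)) = h(E(y) c).  Taking y = K(x) makes the result an identity in
    x. *)
Lemma haar_dC x : h (d * x) = q ^+ 2 * h (x * d).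
Proof.
have := haar_E (c * (K |> x)); have := haar_E ((K |> x) * c).
rewrite !lactE_mul lact_KiK lactKi_c lactE_c lactK_c -scalerAl -scalerAr.
rewrite !haarD !haarZ.
rewrite haar_cC => /eqP; rewrite addr_eq0 => /eqP e1.
move=> /eqP; rewrite addr_eq0 => /eqP e2.
have -> : h (d * x) = q * h (d * (K |> K |> x)).
  rewrite -[in LHS]haar_K -[in LHS]haar_K !lactK_mul !(lactK_d, lactZ).
  by rewrite -!scalerAl !haarZ mulrA.
rewrite e2 -[h (x * d)]opprK -e1; field.
by rewrite s_neq0.
Qed.

(** The same argument with F(b) = a. *)
Lemma haar_aC x : h (a * x) = q ^- 2 * h (x * a).
Proof.
have := haar_F (b * (K |> x)); have := haar_F ((K |> x) * b).
rewrite !lactF_mul lact_KiK lactKi_b lactF_b lactK_b -scalerAl -scalerAr.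
rewrite !haarD !haarZ.
rewrite haar_bC => /eqP; rewrite addr_eq0 => /eqP e1.
move=> /eqP; rewrite addr_eq0 => /eqP e2.
have -> : h (a * x) = q^-1 * h (a * (K |> K |> x)).
  rewrite -[in LHS]haar_K -[in LHS]haar_K !lactK_mul !(lactK_a, lactZ).
  by rewrite -!scalerAl !haarZ; field.
rewrite e2 -[h (x * a)]opprK -e1; field.
by rewrite s_neq0.
Qed.

(** For fixed x the identity is required for all z, which makes the set of such
    x closed under products. *)
Lemma haar_KMS x z : h (x * z) = h (z * ((K * K) |> (x <| K <| K))).
Proof.
elim/presented_ind: x z => [i||x x' IH IH'|x x' IH IH'|r x IH] z.
- case: i; rewrite ?(ractK_a, ractK_b, ractK_c, ractK_d, ractZ, lactZ, lact_comp,
    lactK_a, lactK_b, lactK_c, lactK_d) !scalerA -?scalerAr !haarZ.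
  + by rewrite haar_aC; field.
  + by rewrite haar_bC; field.
  + by rewrite haar_cC; field.
  + by rewrite haar_dC; field.
- by rewrite !(ract1 P (uK_counit s)) (lact1 P (uK2_counit s)) mulr1 mul1r.
- by rewrite mulrDl !(ractD, lactD) mulrDr !haarD IH IH'.
- rewrite -mulrA IH -mulrA IH' !ractK_mul (lactM P (uK2_grouplike s)).
  by rewrite -mulrA.
- by rewrite !(ractZ, lactZ) -scalerAl -scalerAr !haarZ IH.
Qed.

(** * The cyclic cocycle *)

(** Integration by parts: the difference of the two sides is h(EK(x z)) = 0. *)
Lemma haar_EK_parts x z :
  h (((E * K) |> x) * (K ^+ 2 |> z)) = - h (x * ((E * K) |> z)).
Proof.
apply/eqP; rewrite -addr_eq0 -haarD -lactEK_mul haar_lact.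
by rewrite rmorphM /= counit_pgen !mul0r.
Qed.

Lemma haar_KF_parts x z :
  h (((K * F) |> x) * (K ^+ 2 |> z)) = - h (x * ((K * F) |> z)).
Proof.
apply/eqP; rewrite -addr_eq0 -haarD -lactKF_mul haar_lact.
by rewrite rmorphM /= [counit F]counit_pgen mulr0 mul0r.
Qed.

Lemma haar_K2C x : x <| K = x ->
  forall z, h ((K ^+ 2 |> x) * z) = h (z * (K ^+ 4 |> x)).
Proof.
move=> xK z; have zK : (K ^+ 2 |> x) <| K = K ^+ 2 |> x.
  by rewrite expr2 ract_lactK2 xK.
by rewrite haar_KMS !zK -lact_comp -[K * K]expr2 -exprD.
Qed.

Definition tau3 (x0 x1 x2 : O) : k :=
  h (x0 * ((K * F) |> x1) * ((E * K ^+ 3) |> x2))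
  - h (x0 * ((E * K) |> x1) * ((K ^+ 3 * F) |> x2))
  - (q ^+ 3 - q)^-1 * h (x0 * x1 * (K ^+ 4 |> x2)).

Lemma tau3_linear0 x1 x2 : scalar (fun x => tau3 x x1 x2).
Proof.
by move=> r x y; rewrite /tau3 !mulrDl -!scalerAl !haarD !haarZ; ring.
Qed.

Lemma tau3_linear1 x0 x2 : scalar (fun x => tau3 x0 x x2).
Proof.
move=> r x y; rewrite /tau3 !lactD !lactZ !mulrDr !mulrDl.
by rewrite -!(scalerAr, scalerAl) !haarD !haarZ; ring.
Qed.

Lemma tau3_linear2 x0 x1 : scalar (fun x => tau3 x0 x1 x).
Proof.
move=> r x y; rewrite /tau3 !lactD !lactZ !mulrDr.
by rewrite -!scalerAr !haarD !haarZ; ring.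
Qed.

Lemma tau3_hochschild x0 x1 x2 x3 : x3 <| K = x3 ->
  tau3 (x0 * x1) x2 x3 - tau3 x0 (x1 * x2) x3 + tau3 x0 x1 (x2 * x3)
  - tau3 ((K ^+ 2 |> x3) * x0) x1 x2 = 0.
Proof.
move=> x3K; rewrite /tau3 -!(mulrA (K ^+ 2 |> x3)) !(haar_K2C x3K).
rewrite lactEK_mul lactKF_mul lactEK3_mul lactK3F_mul lactK4_mul.
rewrite !(mulrDl, mulrDr) !haarD !mulrA; ring.
Qed.

(** Moving K^2(x2) to the right end by the modular property and then taking the
    twisted derivation off x0 turns h(x0 KF(x1) EK^3(x2)) into
    - h(x0 EK(x1) K^3F(x2)), and conversely, up to terms that [uq_EKKF]
    collects. *)
Lemma tau3_cyclic x0 x1 x2 : x2 <| K = x2 ->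
  tau3 x0 x1 x2 = tau3 (K ^+ 2 |> x2) x0 x1.
Proof.
move=> x2K; rewrite /tau3 -!(mulrA (K ^+ 2 |> x2)) !(haar_K2C x2K).
have e1 : ((E * K ^+ 3) |> x1) * (K ^+ 4 |> x2)
    = q ^- 2 *: (K ^+ 2 |> (((E * K) |> x1) * (K ^+ 2 |> x2))).
  rewrite lactK2_mul -!lact_comp -exprD uq_K2EK lactZl -scalerAl.
  by rewrite scalerK ?q2_neq0.
have e2 : ((K ^+ 3 * F) |> x1) * (K ^+ 4 |> x2)
    = K ^+ 2 |> (((K * F) |> x1) * (K ^+ 2 |> x2)).
  by rewrite lactK2_mul -!lact_comp -exprD mulrA -exprSr.
(* Both products after x0 are now K^2 of something, as integration by parts requires. *)
rewrite -2!(mulrA (_ |> x0)) e1 e2 -scalerAr haarZ haar_KF_parts haar_EK_parts.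
rewrite lactEK_mul lactKF_mul -!lact_comp -exprD uq_EKKF uq_EKK2 uq_KFK2.
(* Names for the composites keep the distribution below out of U_q(su_2). *)
set A := K * F * (E * K); set B := E * K ^+ 3; rewrite (_ : 2 + 2 = 4)%N //.
have e3 : (K ^+ 4 - 1) |> x1 = K ^+ 4 |> x1 - x1.
  by rewrite lactDl -scaleN1r lactZl lact_1l scaleN1r.
rewrite lactDl !lactZl e3 !mulrDl -!scalerAl !mulrDr -!scalerAr.
rewrite !mulrDl !mulrDr !mulNr !mulrN.
rewrite !(haarD, haarZ, haarN) !mulrA; set r := (q ^+ 3 - q)^-1.
by field.
Qed.

(** * Pairing with the idempotent of ad - q bc = 1 *)

Lemma suq_ad1 : a * d = 1 + q *: (b * c).
Proof. by apply/eqP; rewrite -subr_eq suq_det. Qed.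

Lemma suq_da1 : d * a = 1 + q^-1 *: (b * c).
Proof.
apply: (addIr ((q - q^-1) *: (b * c))); rewrite -suq_ad suq_ad1 -addrA -scalerDl.
by rewrite [_^-1 + _]addrC subrK.
Qed.

Lemma suq_bca : b * c * a = q ^- 2 *: (a * (b * c)).
Proof.
rewrite (mulrA a b c) suq_ab -scalerAl -(mulrA b a c) suq_ac -scalerAr !scalerA.
rewrite -(mulrA b) -[LHS]scale1r; congr (_ *: _).
by field; rewrite s_neq0.
Qed.

Hypothesis q_not_root : forall n : nat, (0 < n)%N -> q ^+ n != 1.

Lemma q2B1_neq0 : q ^+ 2 - 1 != 0.
Proof. by rewrite subr_eq0 q_not_root. Qed.
Lemma qnum2_neq0 : 1 + q ^+ 2 != 0.
Proof.
apply/eqP => e; have := q_not_root (n := 4) isT; rewrite -subr_eq0 => /eqP; apply.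
by rewrite [_ - _](_ : _ = (q ^+ 2 - 1) * (1 + q ^+ 2)); [rewrite e mulr0 | ring].
Qed.
Lemma qnum3_neq0 : 1 + q ^+ 2 + q ^+ 4 != 0.
Proof.
apply/eqP => e; have := q_not_root (n := 6) isT; rewrite -subr_eq0 => /eqP; apply.
by rewrite [_ - _](_ : _ = (q ^+ 2 - 1) * (1 + q ^+ 2 + q ^+ 4));
  [rewrite e mulr0 | ring].
Qed.

(** The modular property compares h(a d) with h(d a), and both a d and d a are
    affine in b c. *)
Lemma haar_bc : h (b * c) = - q / (1 + q ^+ 2).
Proof.
have [h1 _ _] := h_haar; have := haar_aC d.
rewrite suq_ad1 suq_da1 !haarD !haarZ h1 => e.
apply: (mulIf q2B1_neq0); apply: (mulIf qnum2_neq0).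
transitivity (q ^+ 3 * (1 + q * h (b * c)) - (q + h (b * c)) - q ^+ 3 + q).
  by field.
by rewrite e; field; rewrite qnum2_neq0 s_neq0.
Qed.

Lemma haar_bcbc : h (b * c * (b * c)) = q ^+ 2 / (1 + q ^+ 2 + q ^+ 4).
Proof.
have := haar_aC (d * (b * c)).
rewrite -(mulrA d) suq_bca -scalerAr !mulrA suq_ad1 suq_da1 -!mulrA !mulrDl.
rewrite !mul1r -!scalerAl (mulrA b c) !(haarZ, haarD).
set x := h (b * c); set y := h _ => e.
apply: (mulIf q2B1_neq0); apply: (mulIf qnum3_neq0).
transitivity (q ^+ 5 * (x + q * y) - (q * x + y) - q ^+ 5 * x + q * x).
  by ring.
by rewrite e /x haar_bc; field; rewrite qnum2_neq0 qnum3_neq0 s_neq0.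
Qed.

Section RankOne.
Variables (u0 u1 v0 v1 : O) (D G : O -> O).
Hypothesis D_add : forall x z, D (x + z) = D x + D z.
Hypothesis vu1 : v0 * u0 + v1 * u1 = 1.
Hypothesis D_mul : forall x z, D (x * z) = D x * (K ^+ 2 |> z) + x * D z.
Hypothesis G_mul : forall x z,
  G (x * z) = G x * (K ^+ 4 |> z) + (K ^+ 2 |> x) * G z.

(** The element X with (sum over j, l of e_ij D(e_jl) G(e_li)) = u_i X K^4(v_i)
    for the rank one idempotent e_ij = u_i v_j. *)
Definition contraction :=
  (v0 * D u0 + v1 * D u1) * ((K ^+ 2 |> v0) * G u0 + (K ^+ 2 |> v1) * G u1)
  + (D v0 * G u0 + D v1 * G u1).

(** For w_l := sum_j v_j D(u_j v_l) one has sum_l w_l K^2(u_l) = D(1) = 0, which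
    kills the terms of the Leibniz rule where G hits z. *)
Lemma contract z :
  (v0 * D (u0 * v0) + v1 * D (u1 * v0)) * G (u0 * z) +
  (v0 * D (u0 * v1) + v1 * D (u1 * v1)) * G (u1 * z) =
  contraction * (K ^+ 4 |> z).
Proof.
rewrite /contraction.
(* A must not unfold to a sum when products are distributed below. *)
have [A eA] : exists A, v0 * D u0 + v1 * D u1 = A by eexists.
have step x : v0 * D (u0 * x) + v1 * D (u1 * x) = A * (K ^+ 2 |> x) + D x.
  by rewrite !D_mul !mulrDr addrACA !mulrA -!mulrDl eA vu1 mul1r.
have D1 : D 1 = 0.
  have := D_mul 1 1; rewrite !mul1r (lact1 P (uK2_counit s)) mulr1.
  by rewrite -[X in X = _ -> _]addr0 => /addrI.
have K21 :
  (K ^+ 2 |> v0) * (K ^+ 2 |> u0) + (K ^+ 2 |> v1) * (K ^+ 2 |> u1) = 1.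
  by rewrite -!lactK2_mul -lactD vu1 (lact1 P (uK2_counit s)).
have A0 : A + (D v0 * (K ^+ 2 |> u0) + D v1 * (K ^+ 2 |> u1)) = 0.
  by rewrite -eA -D1 -vu1 D_add !D_mul [RHS]addrACA [RHS]addrC.
rewrite !step eA; set w0 := A * _ + D v0; set w1 := A * _ + D v1.
have w0K : w0 * (K ^+ 2 |> u0) + w1 * (K ^+ 2 |> u1) = 0.
  by rewrite /w0 /w1 !mulrDl addrACA -!mulrA -mulrDr K21 mulr1.
have wG : w0 * G u0 + w1 * G u1 =
    A * ((K ^+ 2 |> v0) * G u0 + (K ^+ 2 |> v1) * G u1)
    + (D v0 * G u0 + D v1 * G u1).
  by rewrite /w0 /w1 !mulrDl addrACA -!(mulrA A) -mulrDr.
by rewrite -wG !G_mul !mulrDr addrACA !mulrA -!mulrDl w0K mul0r addr0.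
Qed.
End RankOne.

(** The vectors u = (d, -q c) and v = (a, b), with true as the first index; they
    satisfy v u = a d - q b c = 1. *)
Definition uvec (i : bool) : O := if i then d else - q *: c.
Definition vvec (i : bool) : O := if i then a else b.
Definition weight (i : bool) : k := if i then q ^+ 2 else 1.
Definition proj i j := uvec i * vvec j.

Lemma vu1 : vvec true * uvec true + vvec false * uvec false = 1.
Proof. by rewrite /= -scalerAr scaleNr suq_det. Qed.

(** The modular property moves u_i to the right of K^4(v_i); up to the
    factor q^2, the weights turn the result into X times sum_i v_i u_i = 1. *)
Lemma weighted_trace X :
  \sum_i weight i * h (uvec i * (X * (K ^+ 4 |> vvec i))) = q ^+ 2 * h X.
Proof.
rewrite big_bool /= haar_dC -scalerAl haarZ haar_cC !lactK4E.
rewrite !(lactK_a, lactK_b, lactZ) -!(scalerAl, scalerAr) !haarZ -!mulrA.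
rewrite -{3}[X]mulr1 -suq_det -scaleNr mulrDr haarD -scalerAr haarZ.
by field.
Qed.

(** [contract] carries out the sums over j and l, [weighted_trace] the one over
    i. *)
Lemma sum_derivations (D G : O -> O) :
  (forall x z, D (x + z) = D x + D z) ->
  (forall x z, D (x * z) = D x * (K ^+ 2 |> z) + x * D z) ->
  (forall x z, G (x * z) = G x * (K ^+ 4 |> z) + (K ^+ 2 |> x) * G z) ->
  \sum_i \sum_j \sum_l weight i * h (proj i j * D (proj j l) * G (proj l i)) =
  q ^+ 2 * h (contraction d (- q *: c) a b D G).
Proof.
move=> D_add D_mul G_mul; rewrite -weighted_trace; apply: eq_bigr => i _.
rewrite -(contract D_add vu1 D_mul G_mul) !big_bool /proj /=.
rewrite -!mulrDr -!haarD; congr (_ * h _).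
by rewrite !mulrDl !mulrDr !mulrA addrACA.
Qed.

Lemma contraction_KF_EK3 :
  h (contraction d (- q *: c) a b (lact P (K * F)) (lact P (E * K ^+ 3))) =
  - q^-1 * (1 + q * h (b * c)) - q ^- 2 * (h (b * c) + q^-1 * h (b * c * (b * c))).
Proof.
have acbd : h (a * (c * (b * d))) =
    q ^- 2 * (h (b * c) + q^-1 * h (b * c * (b * c))).
  rewrite haar_aC -!mulrA suq_da1 !mulrDr mulr1 -!scalerAr haarD haarZ.
  by rewrite !mulrA -suq_bc; ring.
have ad : h (a * d) = 1 + q * h (b * c).
  by have [h1 _ _] := h_haar; rewrite suq_ad1 haarD haarZ h1.
rewrite -acbd -ad /contraction !lact_comp.
rewrite !(lactZ, lactF_a, lactF_b, lactF_c, lactF_d, lactE_a, lactE_b, lactE_c,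
  lactE_d, lactK_a, lactK_b, lactK_c, lactK_d, raddf0, scaler0).
rewrite !(mulr0, mul0r, add0r, addr0) -!(scalerAl, scalerAr) haarD !haarZ.
by rewrite -!mulrA; field.
Qed.

Lemma contraction_EK_K3F :
  h (contraction d (- q *: c) a b (lact P (E * K)) (lact P (K ^+ 3 * F))) =
  - q ^- 3 * h (b * c * (b * c)).
Proof.
have bdac : h (b * (d * (a * c))) = h (b * c) + q^-1 * h (b * c * (b * c)).
  rewrite haar_bC mulrA suq_da1 -mulrA -suq_bc mulrDl mul1r -scalerAl.
  by rewrite haarD haarZ.
transitivity (q ^- 2 * h (b * c) - q ^- 2 * h (b * (d * (a * c)))); last first.
  by rewrite bdac; field.
rewrite /contraction !lact_comp.
rewrite !(lactZ, lactF_a, lactF_b, lactF_c, lactF_d, lactE_a, lactE_b, lactE_c,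
  lactE_d, lactK_a, lactK_b, lactK_c, lactK_d, raddf0, scaler0).
rewrite !(mulr0, mul0r, add0r, addr0) -!(scalerAl, scalerAr) haarD !haarZ.
by rewrite -!mulrA; field.
Qed.

(** Idempotency removes the sum over j, and K^4 is multiplicative, so that the
    trace of [weighted_trace] applies with X = sum_l v_l K^4(u_l). *)
Lemma sum_K4 :
  \sum_i \sum_j \sum_l weight i * h (proj i j * proj j l * (K ^+ 4 |> proj l i)) =
  q ^+ 2 * (q ^+ 2 + (q ^+ 3 - q^-1) * h (b * c)).
Proof.
have -> : q ^+ 2 + (q ^+ 3 - q^-1) * h (b * c) =
    h (vvec true * (K ^+ 4 |> uvec true) + vvec false * (K ^+ 4 |> uvec false)).
  have [h1 _ _] := h_haar.
  rewrite /= !lactK4E !(lactK_d, lactK_c, lactZ) -!scalerAr haarD !haarZ suq_ad1.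
  by rewrite haarD haarZ h1; field.
rewrite -weighted_trace; apply: eq_bigr => i _.
have /= vu := vu1; rewrite !big_bool /proj /= -!mulrDr -!haarD; congr (_ * h _).
rewrite addrACA !lactK4_mul !mulrA -!mulrDl -!(mulrA (uvec i)) -!mulrDr vu mulr1.
by rewrite [RHS]mulrA mulrDr !mulrA.
Qed.

Lemma tau3_proj :
  \sum_i \sum_j \sum_l weight i * tau3 (proj i j) (proj j l) (proj l i) =
  q / (1 - q ^+ 2).
Proof.
pose t1 i j l := weight i *
  h (proj i j * ((K * F) |> proj j l) * ((E * K ^+ 3) |> proj l i)).
pose t2 i j l := weight i *
  h (proj i j * ((E * K) |> proj j l) * ((K ^+ 3 * F) |> proj l i)).
pose t3 i j l := weight i * h (proj i j * proj j l * (K ^+ 4 |> proj l i)).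
transitivity (\sum_i \sum_j \sum_l t1 i j l - \sum_i \sum_j \sum_l t2 i j l
  - (q ^+ 3 - q)^-1 * \sum_i \sum_j \sum_l t3 i j l).
  do 3 (rewrite mulr_sumr -!sumrB; apply: eq_bigr => ? _).
  by rewrite /t1 /t2 /t3 /tau3; ring.
rewrite /t1 sum_derivations ?contraction_KF_EK3; first last.
- exact: lactEK3_mul.
- exact: lactKF_mul.
- exact: lactD.
rewrite /t2 sum_derivations ?contraction_EK_K3F; first last.
- exact: lactK3F_mul.
- exact: lactEK_mul.
- exact: lactD.
rewrite /t3 sum_K4 haar_bc haar_bcbc.
have n1 := q2B1_neq0; have n1' : 1 - q ^+ 2 != 0 by rewrite -opprB oppr_eq0.
have n1q : q ^+ 3 - q != 0.
  by rewrite (_ : _ - _ = q * (q ^+ 2 - 1)) ?mulf_neq0 ?q_neq0 //; ring.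
by field; rewrite n1' n1q qnum2_neq0 qnum3_neq0 s_neq0.
Qed.

Lemma proj_ractK i j : proj i j <| K = proj i j.
Proof.
rewrite /proj ractK_mul; case: i; case: j => /=;
  rewrite ?ractZ ?(ractK_a, ractK_b, ractK_c, ractK_d);
  rewrite -!(scalerAl, scalerAr) !scalerA;
  first [by rewrite mulfV ?scale1r | by congr (_ *: _); field].
Qed.

Lemma proj_idem i l : \sum_j proj i j * proj j l = proj i l.
Proof.
have /= vu := vu1; rewrite big_bool /proj /= !mulrA -mulrDl.
by rewrite -!(mulrA (uvec i)) -mulrDr vu mulr1.
Qed.

(** This is K^2(e_ij) = r_i r_j^-1 e_ij, free of inverses. *)
Lemma lactK2_proj i j :
  weight j *: (K ^+ 2 |> proj i j) = weight i *: proj i j.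
Proof.
rewrite /proj lactK2_mul expr2 !lact_comp; case: i; case: j => /=;
  rewrite ?(lactZ, lactK_a, lactK_b, lactK_c, lactK_d);
  rewrite -!(scalerAl, scalerAr) !scalerA;
  by congr (_ *: _); field.
Qed.

(** * Restriction to the Podles sphere *)

Definition podles_tau (t : 3.-tuple (podles P)) : k :=
  tau3 (tnth t ord0) (tnth t (lift ord0 ord0)) (tnth t ord_max).

Lemma podles_tauE x0 x1 x2 :
  podles_tau [tuple x0; x1; x2] = tau3 x0 x1 x2.
Proof. by rewrite /podles_tau !(tnth_nth 0). Qed.

Lemma podlesP (x : podles P) : ract P x (uK s) = x.
Proof. exact/eqP/(valP x). Qed.

Lemma podles_tau_multilinear : multilinear podles_tau.
Proof.
move=> t i r y z; have [x0 [x1 [x2 ->]]] := tuple3P t.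
have e w : tset [tuple x0; x1; x2] i w = [tuple if i == ord0 then w else x0;
    if i == lift ord0 ord0 then w else x1; if i == ord_max then w else x2].
  by apply: eq_from_tnth => -[[|[|[|//]]] lt_i3];
    rewrite tnth_mktuple !(tnth_nth 0) /= eq_sym.
rewrite !e !podles_tauE.
case: i {e} => -[|[|[|//]]] lt_i3; rewrite -!val_eqE /=.
- exact: tau3_linear0.
- exact: tau3_linear1.
- exact: tau3_linear2.
Qed.

Lemma podles_tau_cocycle : cyclic_cocycle (sigma_inv P) podles_tau.
Proof.
split; last first.
  move=> t; have [x0 [x1 [x2 [x3 ->]]]] := tuple4P t.
  rewrite hochschild2E !podles_tauE; apply: tau3_hochschild => //.
  exact: podlesP.
split; last first.
  move=> t; have [x0 [x1 [x2 ->]]] := tuple3P t.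
  rewrite twisted_rot2E !podles_tauE -signr_odd mul1r; apply: tau3_cyclic => //.
  exact: podlesP.
exact: podles_tau_multilinear.
Qed.

Hypothesis two_neq0 : 2%:R != 0 :> k.

Lemma podles_tau_not_coboundary : ~ cyclic_coboundary (sigma_inv P) podles_tau.
Proof.
case=> psi [psi_cyc tau_eq].
have pK i j : proj i j \in podles_pred P by apply/eqP/proj_ractK.
pose e i j := Podles (pK i j).
have e_idem i l : \sum_j e i j * e j l = e i l.
  by apply: val_inj; rewrite big_bool /= -(proj_idem i l) big_bool.
have e_theta i j : weight j *: sigma_inv P (e i j) = weight i *: e i j.
  by apply: val_inj; apply: lactK2_proj.
have := hochschild_idempotent e_idem e_theta two_neq0 psi_cyc.
under eq_bigr do under eq_bigr do under eq_bigr do rewrite -tau_eq podles_tauE.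
rewrite tau3_proj => /eqP.
have q1 : 1 - (s ^+ 2) ^+ 2 != 0 by rewrite subr_eq0 eq_sym q_not_root.
by rewrite mulf_eq0 invr_eq0 (negbTE q1) (negbTE q_neq0).
Qed.

End Haar.

End PodlesCocycle.

Theorem corollary4p2 (k : fieldType) (char_k : [pchar k] =i pred0)
    (s : k) (s_neq0 : s != 0)
    (s2_not_root : forall n : nat, (0 < n)%N -> (s ^+ 2) ^+ n != 1)
    (P : dual_pairing s_neq0) (h : {scalar (O_SUq2 s)}) (h_haar : is_haar s_neq0 h) :
  let q := s ^+ 2 in
  let E := uE s in let F := uF s in let K := uK s in
  exists tau : 3.-tuple (podles P) -> k,
    nontrivial_cyclic_cocycle (sigma_inv P) tau /\
    forall x0 x1 x2 : podles P,
      tau [tuple x0; x1; x2] =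
        h (podles_val x0 * lact P (K * F) x1 * lact P (E * K ^+ 3) x2)
        - h (podles_val x0 * lact P (E * K) x1 * lact P (K ^+ 3 * F) x2)
        - (q ^+ 3 - q)^-1
          * h (podles_val x0 * podles_val x1 * lact P (K ^+ 4) x2).
Proof.
have two_neq0 : 2%:R != 0 :> k.
  by apply/negP => k2; have := char_k 2; rewrite inE /= k2.
exists (@podles_tau k s s_neq0 P h); split; last first.
  exact: podles_tauE.
split; first exact: podles_tau_cocycle.
exact: podles_tau_not_coboundary.
Qed.
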